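(* Let $V$ be a vertex operator algebra, let $\tau\in\mathrm{Aut}(V)$ with $o(\tau)=T$, and let $M_2$ and $M_3$ be weak $\tau$-twisted $V$-modules. Then $(\mathcal H(M_2,M_3),Y_{\mathcal H})$ carries the structure of a weak $V$-module. (In particular, $u_n^{\mathcal H}\phi(x)\in\mathcal H(M_2,M_3)$ for all $u\in V$, $n\in\mathbb Z$, $\phi(x)\in\mathcal H(M_2,M_3)$.)
   Context: Notation: $U\{x\}$ denotes formal series $\sum_{\alpha\in\mathbb C}u_\alpha x^\alpha$ with $u_\alpha\in U$; $\delta(z)=\sum_{n\in\mathbb Z}z^n$; powers of binomials are expanded in nonnegative powers of the second variable. $V^r=\{v\in V:\tau v=e^{2\pi ir/T}v\}$. A weak $\tau$-twisted $V$-module is a space $M$ with a linear map $Y_M(\cdot,z):V\to(\mathrm{End}\,M)[[z^{1/T},z^{-1/T}]]$ such that for $u\in V^r$ ($0\le r\le T-1$), $v\in V$, $w\in M$: $Y_M(u,z)=\sum_{n\in r/T+\mathbb Z}u_nz^{-n-1}$; $u_nw=0$ for $n\gg0$; $Y_M(\mathbf 1,z)=\mathrm{Id}$; and $z_0^{-1}\delta(\frac{z_1-z_2}{z_0})Y_M(u,z_1)Y_M(v,z_2)-z_0^{-1}\delta(\frac{z_2-z_1}{-z_0})Y_M(v,z_2)Y_M(u,z_1)=z_2^{-1}(\frac{z_1-z_0}{z_2})^{-r/T}\delta(\frac{z_1-z_0}{z_2})Y_M(Y(u,z_0)v,z_2)$. A weak $V$-module is the case $\tau=1$. $\mathcal H(M_2,M_3)$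 is the space of generalized intertwining operators from $M_2$ to $M_3$: elements $\phi(x)=\sum_{\alpha\in\mathbb C}\phi_\alpha x^{-\alpha-1}\in(\mathrm{Hom}(M_2,M_3))\{x\}$ such that (G1) for any $\alpha\in\mathbb C$, $w\in M_2$, $\phi_{\alpha+n}w=0$ for $n\in\mathbb Z$ sufficiently large; (G2) $[L(-1),\phi(x)]=\frac{d}{dx}\phi(x)$; (G3) for any $v\in V$ there is a nonnegative integer $k$ with $(x_1-x_2)^kY_{M_3}(v,x_1)\phi(x_2)=(x_1-x_2)^k\phi(x_2)Y_{M_2}(v,x_1)$. For $u\in V^r$ with $0\le r<T$, $\phi(x)\in\mathcal H(M_2,M_3)$ and $n\in\mathbb Z$, define $$u_n^{\mathcal H}\phi(x)=\mathrm{Res}_{x_1}\sum_{j\ge0}\binom{-r/T}{j}x^{-\frac rT-j}x_1^{\frac rT}\left((x_1-x)^{n+j}Y_{M_3}(u,x_1)\phi(x)-(-x+x_1)^{n+j}\phi(x)Y_{M_2}(u,x_1)\right)$$ (a finite sum by (G3)), extend linearly to $u\in V$, and put $Y_{\mathcal H}(u,z)\phi(x)=\sum_{n\in\mathbb Z}u_n^{\mathcal H}\phi(x)z^{-n-1}$. *)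

(* Defs.v *)
From HB Require Import structures.
From mathcomp Require Import all_boot all_order all_algebra.
From mathcomp Require Import all_classical all_reals all_analysis.
From mathcomp Require Import complex.
From mathcomp Require Import ring lra zify.

Set Implicit Arguments.
Unset Strict Implicit.
Unset Printing Implicit Defensive.

Import Order.TTheory GRing.Theory Num.Theory.
Local Open Scope classical_set_scope.
Local Open Scope ring_scope.
Local Open Scope complex_scope.

(** The complex numbers are R[i] for R : realType.  Infinite sums
    [\sum_(j \in A) F j] are MathComp-Analysis' finitely supported sums. *)

Definition expi (R : realType) (t : R) : R[i] := cos t +i* sin t.

(** e^{2 pi i r / T} *)
Definition zeta (R : realType) (T r : nat) : R[i] :=
  expi (2 * pi * r%:R / T%:R).

Definition binom (R : realType) (s : R[i]) (j : nat) : R[i] :=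
  (\prod_(i < j) (s - i%:R)) / j`!%:R.

(** A formal series is represented by its modes: [F a b] is the coefficient of
    x1^{-a-1} x2^{-b-1}.  The exponents of x1 and x2 range over abelian groups
    in which the exponent 1 is e1, resp. e2.  For series in z^{1/T}, the mode
    k : int stands for the exponent -k/T-1, so that e = T there. *)
Section BinomialPowers.
Variables (R : realType) (E1 E2 : zmodType) (e1 : E1) (e2 : E2).
Variable W : lmodType R[i].

(** (x1 - x2)^n F, with (x1 - x2)^n = sum_j binom(n,j) (-1)^j x1^{n-j} x2^j *)
Definition mul_x1Bx2 (n : int) (F : E1 -> E2 -> W) (a : E1) (b : E2) : W :=
  \sum_(j \in [set: nat]) ((-1) ^+ j * binom n%:~R j) *:
    F (a + e1 *~ (n - j%:Z)) (b + e2 *~ j%:Z).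

(** (- x2 + x1)^n F, with
    (- x2 + x1)^n = sum_j binom(n,j) (-1)^{n-j} x2^{n-j} x1^j *)
Definition mul_Nx2Dx1 (n : int) (F : E1 -> E2 -> W) (a : E1) (b : E2) : W :=
  \sum_(j \in [set: nat]) ((-1) ^ (n - j%:Z) * binom n%:~R j) *:
    F (a + e1 *~ j%:Z) (b + e2 *~ (n - j%:Z)).

End BinomialPowers.

(** The (twisted) Jacobi identity for u in V^r, v and w, as an equality of the
    coefficients of z0^{-n-1} z1^{-a/T-1} z2^{-b/T-1}.
    On the left, z0^{-1} delta((z1-z2)/z0) = sum_n (z1-z2)^n z0^{-n-1} and
    z0^{-1} delta((z2-z1)/(-z0)) = sum_n (-z2+z1)^n z0^{-n-1}.
    On the right, z2^{-1} ((z1-z0)/z2)^{-r/T} delta((z1-z0)/z2) is the sum over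
    k in Z and j >= 0 of
      binom(k-r/T,j) (-1)^j z0^j z1^{k-r/T-j} z2^{-k-1+r/T},
    and the index set consists of the (k,j) with k-r/T-j = -a/T-1. *)
Definition jacobi (R : realType) (V M : lmodType R[i])
    (YV : V -> int -> V -> V) (T r : nat) (YM : V -> int -> M -> M)
    (u v : V) (w : M) : Prop :=
  forall n a b : int,
    mul_x1Bx2 T%:Z T%:Z n (fun k l => YM u k (YM v l w)) a b
    - mul_Nx2Dx1 T%:Z T%:Z n (fun k l => YM v l (YM u k w)) a b
    = \sum_(kj \in [set kj : int * nat |
              kj.1 * T%:Z - r%:Z - kj.2%:Z * T%:Z = - a - T%:Z])
        ((-1) ^+ kj.2 * binom (kj.1%:~R - r%:R / T%:R) kj.2) *:
          YM (YV u (n + kj.2%:Z) v) (b - kj.1 * T%:Z - T%:Z + r%:Z) w.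

(** [voa_Y u n v] is u_n v, where Y(u,z) = sum_n u_n z^{-n-1}. *)
Record voa (R : realType) := VOA {
  voa_car :> lmodType R[i];
  voa_Y : voa_car -> int -> voa_car -> voa_car;
  voa_vac : voa_car;
  voa_omega : voa_car;
  voa_charge : R[i];
  voa_gr : int -> set voa_car;
  voa_L := fun n : int => voa_Y voa_omega (n + 1);
  voa_gr_sub : forall n,
    voa_gr n 0 /\
    forall (a : R[i]) u v, voa_gr n u -> voa_gr n v -> voa_gr n (a *: u + v);
  voa_gr_direct : forall v, exists! f : int -> voa_car,
    [/\ forall n, voa_gr n (f n), finite_set [set n | f n != 0] &
        v = \sum_(n \in [set: int]) f n];
  voa_gr_findim : forall n, exists (d : nat) (b : 'I_d -> voa_car),
    (forall i, voa_gr n (b i)) /\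
    forall v, voa_gr n v -> exists c : 'I_d -> R[i], v = \sum_i c i *: b i;
  voa_gr_bounded : exists N : int, forall n, n < N ->
    forall v, voa_gr n v -> v = 0;
  voa_vac_gr : voa_gr 0 voa_vac;
  voa_omega_gr : voa_gr 2 voa_omega;
  voa_Y_linearl : forall n v, linear (fun u => voa_Y u n v);
  voa_Y_linearr : forall u n, linear (voa_Y u n);
  voa_trunc : forall u v, exists N : int, forall n, N <= n -> voa_Y u n v = 0;
  voa_vacuum : forall n v, voa_Y voa_vac n v = if n == -1 then v else 0;
  voa_creation : forall v,
    voa_Y v (-1) voa_vac = v /\ forall n, 0 <= n -> voa_Y v n voa_vac = 0;
  voa_jacobi : forall u v w, jacobi voa_Y 1 0 voa_Y u v w;
  voa_virasoro : forall m n v,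
    voa_L m (voa_L n v) - voa_L n (voa_L m v)
    = (m - n)%:~R *: voa_L (m + n) v
      + (if m + n == 0 then (m ^+ 3 - m)%:~R / 12%:R * voa_charge else 0) *: v;
  voa_L0 : forall n v, voa_gr n v -> voa_L 0 v = n%:~R *: v;
  voa_derivation : forall v n w,
    voa_Y (voa_L (-1) v) n w = (- n)%:~R *: voa_Y v (n - 1) w
}.

Definition voa_automorphism (R : realType) (V : voa R) (tau : V -> V) : Prop :=
  [/\ linear tau, bijective tau, tau (voa_vac V) = voa_vac V,
      tau (voa_omega V) = voa_omega V &
      forall u n v, tau (voa_Y u n v) = voa_Y (tau u) n (tau v)].

Definition has_order (A : Type) (tau : A -> A) (T : nat) : Prop :=
  [/\ (0 < T)%N, iter T tau =1 id &
      forall k, (0 < k < T)%N -> ~ (iter k tau =1 id)].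

(** The subspace V^r. *)
Definition eigsp (R : realType) (V : voa R) (tau : V -> V) (T r : nat) : set V :=
  [set v | tau v = zeta R T r *: v].

(** [Y u k] is the mode u_{k/T}, that is, the coefficient of z^{-k/T-1} in
    Y_M(u,z).  Weak V-modules are obtained for tau = id and T = 1. *)
Record is_weak_twisted_module (R : realType) (V : voa R) (tau : V -> V)
    (T : nat) (M : lmodType R[i]) (Y : V -> int -> M -> M) : Prop := {
  wtm_linearl : forall k w, linear (fun u => Y u k w);
  wtm_linearr : forall u k, linear (Y u k);
  wtm_exponents : forall r u, (r < T)%N -> eigsp tau T r u ->
    forall k : int, ~~ (T%:Z %| k - r%:Z)%Z -> forall w, Y u k w = 0;
  wtm_trunc : forall r u w, (r < T)%N -> eigsp tau T r u ->
    exists N : int, forall k, N <= k -> Y u k w = 0;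
  wtm_vacuum : forall k w, Y (voa_vac V) k w = if k == - T%:Z then w else 0;
  wtm_jacobi : forall r u v w, (r < T)%N -> eigsp tau T r u ->
    jacobi (@voa_Y R V) T r Y u v w
}.

Definition is_weak_module (R : realType) (V : voa R) (M : lmodType R[i])
    (Y : V -> int -> M -> M) : Prop :=
  is_weak_twisted_module id 1 Y.

Record weak_twisted_module (R : realType) (V : voa R) (tau : V -> V) (T : nat) :=
  WeakTwistedModule {
    wtm_car :> lmodType R[i];
    wtm_Y : V -> int -> wtm_car -> wtm_car;
    wtm_axioms : is_weak_twisted_module tau T wtm_Y
  }.

(** d/dx of sum_alpha phi_alpha x^{-alpha-1} *)
Definition formal_deriv (R : realType) (A : Type) (W : lmodType R[i])
    (phi : R[i] -> A -> W) : R[i] -> A -> W :=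
  fun alpha w => - alpha *: phi (alpha - 1) w.

Section Intertwiners.
Variables (R : realType) (V : voa R) (tau : V -> V) (T : nat).
Variables (M2 M3 : weak_twisted_module tau T).

(** [phi alpha] is the coefficient of x^{-alpha-1} in phi(x).
    In (G2), L(-1) = omega_0. *)
Record is_intertwiner (phi : R[i] -> M2 -> M3) : Prop := {
  intw_linear : forall alpha, linear (phi alpha);
  intw_G1 : forall alpha w, exists N : int, forall n : int, N <= n ->
    phi (alpha + n%:~R) w = 0;
  intw_G2 : forall alpha w,
    wtm_Y (voa_omega V) 0 (phi alpha w) - phi alpha (wtm_Y (voa_omega V) 0 w)
    = formal_deriv phi alpha w;
  intw_G3 : forall v : V, exists k : nat, forall (a : int) (beta : R[i]) w,
    mul_x1Bx2 T%:Z 1 k%:Z (fun m alpha => wtm_Y v m (phi alpha w)) a beta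
    = mul_x1Bx2 T%:Z 1 k%:Z (fun m alpha => phi alpha (wtm_Y v m w)) a beta
}.

(** The coefficient of x^{-alpha-1} in u_n^H phi(x) for u in V^r: the factor
    x^{-r/T-j} shifts alpha to alpha-r/T-j, and Res_{x1} x1^{r/T} extracts the
    coefficient of x1^{-r/T-1}, which has index r. *)
Definition intw_mode_homog (r : nat) (u : V) (n : int)
    (phi : R[i] -> M2 -> M3) : R[i] -> M2 -> M3 :=
  fun alpha w =>
    \sum_(j \in [set: nat]) binom (- (r%:R / T%:R)) j *:
      (mul_x1Bx2 T%:Z 1 (n + j%:Z)
         (fun m beta => wtm_Y u m (phi beta w))
         r%:Z (alpha - r%:R / T%:R - j%:R)
       - mul_Nx2Dx1 T%:Z 1 (n + j%:Z)
         (fun m beta => phi beta (wtm_Y u m w))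
         r%:Z (alpha - r%:R / T%:R - j%:R)).

(** The component in V^r of u; see [eigproj_in], [eigproj_sum]. *)
Definition eigproj (r : nat) (u : V) : V :=
  T%:R^-1 *: \sum_(s < T) (zeta R T r)^- s *: iter s tau u.

(** u_n^H phi(x) for arbitrary u in V; see [intw_mode_eigsp]. *)
Definition intw_mode (u : V) (n : int) (phi : R[i] -> M2 -> M3) :
    R[i] -> M2 -> M3 :=
  \sum_(r < T) intw_mode_homog r (eigproj r u) n phi.

End Intertwiners.

Section BinomialLemmas.
Variable R : realType.

Lemma binom_nat (k j : nat) : binom (k%:R : R[i]) j = 'C(k, j)%:R.
Proof.
elim: j => [|j IH]; first by rewrite /binom big_ord0 bin0 fact0 divr1.
have -> : binom (k%:R : R[i]) j.+1 = binom k%:R j * (k%:R - j%:R) / j.+1%:R.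
  rewrite /binom big_ord_recr /= factS natrM invfM -!mulrA; congr (_ * _).
  by rewrite [RHS]mulrCA; congr (_ * _); rewrite mulrC.
rewrite IH; have [kj|jk] := ltnP k j.
  by rewrite !bin_small ?mul0r // ltnW.
apply: (@mulIf _ j.+1%:R); first by rewrite pnatr_eq0.
by rewrite mulfVK ?pnatr_eq0// -natrB// -!natrM mulnC -mul_bin_left mulnC.
Qed.

Variables (E1 E2 : zmodType) (e1 : E1) (e2 : E2) (W : lmodType R[i]).

Lemma mul_x1Bx2_nat (k N : nat) (F : E1 -> E2 -> W) a b : (k < N)%N ->
  mul_x1Bx2 e1 e2 k%:Z F a b
  = \sum_(j < N) ((-1) ^+ j * 'C(k, j)%:R) *:
      F (a + e1 *~ (k%:Z - j%:Z)) (b + e2 *~ j%:Z).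
Proof.
move=> kN; rewrite /mul_x1Bx2.
pose G j : W := ((-1) ^+ j * 'C(k, j)%:R) *:
      F (a + e1 *~ (k%:Z - j%:Z)) (b + e2 *~ j%:Z).
rewrite (_ : \sum_(j < N) _ = \sum_(j < N) G j)// (fsbig_ord _ _ G).
rewrite (eq_fsbigr G); last by move=> j _; rewrite /G -binom_nat.
apply/esym/fsbig_widen => // j [_ /=] /negP; rewrite -leqNgt => Nj.
by rewrite /G bin_small ?mulr0 ?scale0r// (leq_trans kN).
Qed.

Lemma mul_x1Bx2_linear (k : nat) (c : R[i]) (F G : E1 -> E2 -> W) a b :
  mul_x1Bx2 e1 e2 k%:Z (fun m n => c *: F m n + G m n) a b
  = c *: mul_x1Bx2 e1 e2 k%:Z F a b + mul_x1Bx2 e1 e2 k%:Z G a b.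
Proof.
rewrite !(mul_x1Bx2_nat _ _ _ (ltnSn k)) scaler_sumr -big_split /=.
by apply: eq_bigr => j _; rewrite scalerDr !scalerA [c * _]mulrC.
Qed.

Lemma mul_x1Bx2S (k : nat) (F : E1 -> E2 -> W) a b :
  mul_x1Bx2 e1 e2 k.+1%:Z F a b
  = mul_x1Bx2 e1 e2 k%:Z F (a + e1) b - mul_x1Bx2 e1 e2 k%:Z F a (b + e2).
Proof.
rewrite (mul_x1Bx2_nat _ _ _ (ltnSn k.+1)) (mul_x1Bx2_nat _ _ _ (ltnW (ltnSn k.+1))).
rewrite (mul_x1Bx2_nat _ _ _ (ltnSn k)).
rewrite [in LHS]big_ord_recl [in RHS]big_ord_recl /=.
rewrite -addrA; congr (_ + _).
  rewrite !bin0; congr (_ *: F _ _).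
  by rewrite !subr0 -addrA -{2}(mulr1z e1) -mulrzDr intS.
rewrite -sumrB; apply: eq_bigr => j _ /=.
rewrite /bump /= !add1n binS natrD mulrDr scalerDl; congr (_ + _).
  congr (_ *: F _ _); rewrite -addrA; congr (_ + _).
  by rewrite -{2}(mulr1z e1) -mulrzDr; congr (_ *~ _); lia.
rewrite exprS mulN1r mulNr scaleNr; congr (- (_ *: F _ _)).
  by congr (_ + _ *~ _); lia.
by rewrite -addrA -{2}(mulr1z e2) -mulrzDr intS.
Qed.

Lemma mul_x1Bx2_leq (k l : nat) (F G : E1 -> E2 -> W) : (k <= l)%N ->
  (forall a b, mul_x1Bx2 e1 e2 k%:Z F a b = mul_x1Bx2 e1 e2 k%:Z G a b) ->
  forall a b, mul_x1Bx2 e1 e2 l%:Z F a b = mul_x1Bx2 e1 e2 l%:Z G a b.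
Proof.
move=> /subnK <-; elim: (l - k)%N => [//|d IH] FG a b.
by rewrite addSn !mul_x1Bx2S !IH.
Qed.

End BinomialLemmas.

Section IntertwinerSpace.
Variables (R : realType) (V : voa R) (tau : V -> V) (T : nat).
Variables (M2 M3 : weak_twisted_module tau T).

Definition intw_pred : {pred R[i] -> M2 -> M3} :=
  fun phi => `[< is_intertwiner phi >].

Lemma intw_pred_submod : submod_closed intw_pred.
Proof.
have Y3 := wtm_axioms M3.
have Y3lin u k c (x y : M3) : wtm_Y u k (c *: x + y) = c *: wtm_Y u k x + wtm_Y u k y.
  exact: wtm_linearr Y3 u k c x y.
have Y30 u k : wtm_Y u k (0 : M3) = 0.
  by have := Y3lin u k (-1) 0 0; rewrite !scaleN1r !addNr.
split.
  apply/asboolP; split.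
  - by move=> alpha c x y; rewrite scaler0 addr0.
  - by move=> alpha w; exists 0.
  - by move=> alpha w; rewrite /formal_deriv Y30 subr0 scaler0.
  - move=> v; exists 0%N => a b w.
    by congr (mul_x1Bx2 _ _ _ _ _ _); apply/funext => m; apply/funext => n.
move=> c phi psi /asboolP Hphi /asboolP Hpsi; apply/asboolP; split.
- move=> alpha d x y.
  change (c *: phi alpha (d *: x + y) + psi alpha (d *: x + y) =
    d *: (c *: phi alpha x + psi alpha x) + (c *: phi alpha y + psi alpha y)).
  rewrite (intw_linear Hphi) (intw_linear Hpsi).
  by rewrite !scalerDr !scalerA [d * c]mulrC addrACA.
- move=> alpha w.
  have [N1 H1] := intw_G1 Hphi alpha w; have [N2 H2] := intw_G1 Hpsi alpha w.
  exists (Num.max N1 N2) => n; rewrite ge_max => /andP[/H1 h1 /H2 h2].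
  change (c *: phi (alpha + n%:~R) w + psi (alpha + n%:~R) w = 0).
  by rewrite h1 h2 scaler0 addr0.
- move=> alpha w; rewrite /formal_deriv.
  change (wtm_Y (voa_omega V) 0 (c *: phi alpha w + psi alpha w) -
    (c *: phi alpha (wtm_Y (voa_omega V) 0 w) +
     psi alpha (wtm_Y (voa_omega V) 0 w)) =
   - alpha *: (c *: phi (alpha - 1) w + psi (alpha - 1) w)).
  rewrite Y3lin opprD addrACA -scalerBr (intw_G2 Hphi) (intw_G2 Hpsi).
  by rewrite /formal_deriv scalerDr !scalerA [c * _]mulrC.
- move=> v.
  have [k1 H1] := intw_G3 Hphi v; have [k2 H2] := intw_G3 Hpsi v.
  exists (maxn k1 k2) => a b w.
  transitivity (mul_x1Bx2 T%:Z 1 (maxn k1 k2)%:Z (fun m alpha =>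
     c *: wtm_Y v m (phi alpha w) + wtm_Y v m (psi alpha w)) a b).
    congr (mul_x1Bx2 _ _ _ _ _ _); apply/funext => m; apply/funext => n.
    exact: Y3lin.
  rewrite mul_x1Bx2_linear.
  rewrite (mul_x1Bx2_leq (leq_maxl k1 k2) (fun a b => H1 a b w)).
  rewrite (mul_x1Bx2_leq (leq_maxr k1 k2) (fun a b => H2 a b w)).
  by rewrite -mul_x1Bx2_linear.
Qed.

HB.instance Definition _ :=
  GRing.isSubmodClosed.Build R[i] (R[i] -> M2 -> M3) intw_pred intw_pred_submod.

(** The vector space H(M2,M3). *)
Record intw_space := IntwSpace {
  intw_val :> R[i] -> M2 -> M3;
  _ : intw_val \in intw_pred
}.

HB.instance Definition _ := [isSub for intw_val].
HB.instance Definition _ := [Choice of intw_space by <:].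
HB.instance Definition _ := [SubChoice_isSubLmodule of intw_space by <:].

Lemma intw_valP (phi : intw_space) : is_intertwiner phi.
Proof. by case: phi => phi /= /asboolP. Qed.

End IntertwinerSpace.

Section EigenspaceDecomposition.
Variable R : realType.

Lemma expiD (a b : R) : expi (a + b) = expi a * expi b.
Proof.
by apply/eqP; rewrite eq_complex /= cosD sinD; apply/andP; split; apply/eqP; ring.
Qed.

Lemma expiMn (a : R) n : expi (a *+ n) = expi a ^+ n.
Proof.
elim: n => [|n IH]; first by rewrite mulr0n expr0 /expi cos0 sin0.
by rewrite mulrSr expiD IH exprSr.
Qed.

Lemma zetaE (T r : nat) : zeta R T r = expi (2 * pi / T%:R) ^+ r.
Proof. by rewrite /zeta -expiMn mulrAC mulr_natr. Qed.

Lemma prim_zeta (T : nat) : (0 < T)%N -> T.-primitive_root (zeta R T 1).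
Proof.
move=> T0; have TR : 0 < T%:R :> R by rewrite ltr0n.
rewrite /primitive_root_of_unity T0; apply/forallP => -[k kT] /=; apply/eqP.
rewrite unity_rootE /zeta -expiMn mulr1.
have [->|kT'] := eqVneq k.+1 T.
  rewrite -[X in expi X]mulr_natr mulfVK ?lt0r_neq0//.
  rewrite (_ : 2 * pi = pi + pi :> R); last by ring.
  rewrite expiD /expi cospi sinpi eq_complex /=.
  by apply/andP; split; apply/eqP; ring.
apply/negbTE/eqP => -[+ _]; pose y : R := pi * k.+1%:R / T%:R.
have -> : (2 * pi / T%:R *+ k.+1) = y + y :> R.
  by rewrite -[LHS]mulr_natr /y; field; rewrite lt0r_neq0.
have siny : 0 < sin y.
  apply: sin_gt0_pi; rewrite /y divr_gt0 ?mulr_gt0 ?pi_gt0 ?ltr0n//=.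
  rewrite ltr_pdivrMr// ltr_pM2l ?pi_gt0// ltr_nat.
  by rewrite ltn_neqAle kT' /= kT.
rewrite cosD -!expr2 => e; have := cos2Dsin2 y; rewrite -[X in _ = X]e.
nra.
Qed.

Lemma sum_expr_unity (T : nat) (z : R[i]) :
  z ^+ T = 1 -> z != 1 -> \sum_(i < T) z ^+ i = 0.
Proof.
move=> zT z1; apply: (@mulfI _ (z - 1)); first by rewrite subr_eq0.
by rewrite -subrX1 zT subrr mulr0.
Qed.

Lemma zetaX (T r : nat) : zeta R T r = zeta R T 1 ^+ r.
Proof. by rewrite !zetaE expr1. Qed.

Lemma zeta_expT (T r : nat) : (0 < T)%N -> zeta R T r ^+ T = 1.
Proof.
by move=> T0; rewrite zetaX exprAC (prim_expr_order (prim_zeta T0)) expr1n.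
Qed.

Lemma zeta_neq0 (T r : nat) : (0 < T)%N -> zeta R T r != 0.
Proof.
move=> T0; apply/eqP => z0; have := zeta_expT r T0.
by rewrite z0 expr0n gtn_eqF//= => /eqP; rewrite eq_sym oner_eq0.
Qed.

Variables (V : voa R) (tau : V -> V) (T : nat).
Hypotheses (aut_tau : voa_automorphism tau) (ord_tau : has_order tau T).

Let T_gt0 : (0 < T)%N. Proof. by case: ord_tau. Qed.

Let tau_lin : linear tau. Proof. by case: aut_tau. Qed.

Let T_neq0 : T%:R != 0 :> R[i]. Proof. by rewrite pnatr_eq0 -lt0n. Qed.

Lemma eigproj_in r u : eigsp tau T r (eigproj tau T r u).
Proof.
have tauD x y : tau (x + y) = tau x + tau y.
  by have := tau_lin 1 x y; rewrite !scale1r.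
have tau0 : tau 0 = 0.
  by have := tau_lin (-1) 0 0; rewrite !scaleN1r !addNr.
have tauZ c x : tau (c *: x) = c *: tau x.
  by have := tau_lin c x 0; rewrite tau0 !addr0.
rewrite /eigsp /= /eigproj tauZ !scalerA [_ * T%:R^-1]mulrC -!scalerA.
congr (_ *: _); rewrite (big_morph tau tauD tau0) scaler_sumr.
pose F i := (zeta R T r * zeta R T r ^- i) *: iter i tau u.
transitivity (\sum_(i < T) F i.+1).
  apply: eq_bigr => i _; rewrite tauZ /F -iterS; congr (_ *: _).
  by rewrite exprS invfM mulrA divff ?mul1r// zeta_neq0.
rewrite [RHS](eq_bigr (fun i : 'I_T => F i)); last first.
  by move=> i _; rewrite /F scalerA.
have F0T : F T = F 0%N.
  rewrite /F zeta_expT// expr0; congr (_ *: _).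
  by case: ord_tau => _ -> _.
rewrite -(big_mkord xpredT (fun i => F i.+1)) -(big_mkord xpredT F).
apply: (@addrI _ (F 0%N)).
by rewrite -big_nat_recl// big_nat_recr//= F0T addrC.
Qed.

Lemma eigproj_sum u : \sum_(r < T) eigproj tau T r u = u.
Proof.
rewrite /eigproj -scaler_sumr exchange_big /=.
have sumE (s : 'I_T) : \sum_(r < T) zeta R T r ^- s *: iter s tau u =
    if s == 0%N :> nat then T%:R *: u else 0.
  rewrite -scaler_suml; have [->|s0] := eqVneq (s : nat) 0%N.
    congr (_ *: _); rewrite (eq_bigr (fun=> 1)); last by move=> i _; rewrite expr0 invr1.
    by rewrite sumr_const card_ord.
  rewrite (eq_bigr (fun r : 'I_T => (zeta R T 1 ^- s) ^+ r)); last first.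
    by move=> r _; rewrite zetaX -exprM mulnC exprM exprVn.
  rewrite sum_expr_unity ?scale0r//.
    by rewrite exprVn exprAC zeta_expT// expr1n invr1.
  rewrite invr_eq1 -(expr0 (zeta R T 1)) (eq_prim_root_expr (prim_zeta T_gt0)).
  by rewrite eqn_mod_dvd// subn0 gtnNdvd// lt0n.
rewrite (eq_bigr _ (fun s _ => sumE s)) -big_mkcond /=.
rewrite (big_pred1 (Ordinal T_gt0)) //.
by rewrite scalerA mulVf// scale1r.
Qed.

Lemma eigproj_eigsp r s u : (r < T)%N -> (s < T)%N -> eigsp tau T r u ->
  eigproj tau T s u = if s == r then u else 0.
Proof.
move=> rT sT ur.
have tau0 : tau 0 = 0.
  by have := tau_lin (-1) 0 0; rewrite !scaleN1r !addNr.
have tauZ c x : tau (c *: x) = c *: tau x.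
  by have := tau_lin c x 0; rewrite tau0 !addr0.
have iterE i : iter i tau u = zeta R T r ^+ i *: u.
  elim: i => [|i IH]; first by rewrite expr0 scale1r.
  by rewrite iterS IH tauZ ur scalerA exprSr.
rewrite /eigproj (eq_bigr (fun i : 'I_T => (zeta R T r / zeta R T s) ^+ i *: u)).
  rewrite -scaler_suml scalerA; have [->|sr] := eqVneq s r.
    rewrite divff ?zeta_neq0// (eq_bigr (fun=> 1)); last by move=> i _; rewrite expr1n.
    by rewrite sumr_const card_ord mulVf// scale1r.
  rewrite sum_expr_unity ?mulr0 ?scale0r//.
    by rewrite expr_div_n !zeta_expT// divr1.
  apply: contra_neq sr => /divr1_eq; rewrite zetaX [zeta R T s]zetaX => /eqP.
  by rewrite (eq_prim_root_expr (prim_zeta T_gt0)) !modn_small// => /eqP.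
by move=> i _; rewrite iterE scalerA mulrC expr_div_n.
Qed.

Variables (M2 M3 : weak_twisted_module tau T).

Lemma intw_mode_homog0 r n (phi : R[i] -> M2 -> M3) :
  (forall alpha, linear (phi alpha)) -> intw_mode_homog r 0 n phi = 0.
Proof.
move=> philin.
have Y0 (M : weak_twisted_module tau T) k (w : M) : wtm_Y 0 k w = 0.
  have := wtm_linearl (wtm_axioms M) k w (-1) 0 0.
  by rewrite !scaleN1r !addNr.
have phi0 alpha : phi alpha 0 = 0.
  by have := philin alpha (-1) 0 0; rewrite !scaleN1r !addNr.
apply/funext => alpha; apply/funext => w.
rewrite /intw_mode_homog; apply: fsbig1 => j _.
rewrite /mul_x1Bx2 /mul_Nx2Dx1 !fsbig1 ?subrr ?scaler0// => i _.
  by rewrite Y0 phi0 scaler0.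
by rewrite Y0 scaler0.
Qed.

Lemma intw_mode_eigsp r u n (phi : R[i] -> M2 -> M3) : (r < T)%N ->
  (forall alpha, linear (phi alpha)) -> eigsp tau T r u ->
  intw_mode u n phi = intw_mode_homog r u n phi.
Proof.
move=> rT philin ur; rewrite /intw_mode (bigD1 (Ordinal rT)) //=.
rewrite (eigproj_eigsp rT rT ur) eqxx big1 ?addr0// => s sr.
rewrite (eigproj_eigsp rT (ltn_ord s) ur) ifN ?intw_mode_homog0//.
Qed.

End EigenspaceDecomposition.

(* Main.v *)
(* For u in V^r and an intertwining operator phi, locality provides k such that
   f(x1,x) = (x1 - x)^k Y(u,x1) phi(x) is bounded below in both variables, and
   then Y_H(u,z) phi(x) = z^{-k} f(x + z, x).  Closure of H(M2,M3) follows: (G1) is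
   immediate, (G2) is the chain rule and (G3) is Dong's lemma.  For the Jacobi
   identity let G(x1,x2,x) be Y(u,x1) Y(v,x2) phi(x) multiplied by
   (x1 - x)^k (x2 - x)^l (x1 - x2)^m, which is bounded below in all three variables,
   and put H(z1,z2) = G(x + z1, x + z2, x), a power series in z1 and z2.  The products
   Y_H(u,z1) Y_H(v,z2) phi and Y_H(v,z2) Y_H(u,z1) phi are the two expansions of
   z1^{-k} z2^{-l} (z1 - z2)^{-m} H(z1,z2), and Y_H(Y(u,z0)v,z2) phi comes from
   H(z2 + z0, z2); this gives locality and weak associativity.  The defect of the
   Borcherds identity with exponent n satisfies
   J_{n+1}(p,q) = J_n(p+1,q) - J_n(p,q+1); it vanishes for n >= m by locality, and
   J_n(k,q) = 0 by weak associativity, so descending induction on n shows J_n = 0. *)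
Require Import Defs.
From mathcomp Require Import all_boot all_order all_algebra.
From mathcomp Require Import all_classical all_reals all_analysis.
From mathcomp Require Import complex.
From mathcomp Require Import ring lra zify.

Set Implicit Arguments.
Unset Strict Implicit.
Unset Printing Implicit Defensive.

Import Order.TTheory GRing.Theory Num.Theory.
Local Open Scope classical_set_scope.
Local Open Scope ring_scope.
Local Open Scope complex_scope.

(** * Sums over the integers and binomial coefficients *)

(** An intertwining operator has arbitrary complex exponents, but all operations move them by
    integers and by fractions r/T. Once a vector w and a coset of exponents are fixed, each product
    is a function on an integer lattice, and the fractional parts survive only as offsets inside
    binomial coefficients. The substitution x1 = x + z requires (x + z)^{-r/T} expanded in powers of
    z. The factors binom(-r/T, j) in the definition of u_n^H are what Vandermonde's identity merges
    with the binomials of integral powers to produce it. The obstacle is that locality exponents are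
    not uniform: the power of x1 - x that bounds Y(u,x1) (v_q phi)(x) depends on q, and the one for
    u_n v depends on n. Two facts remove it: z^{-K} times the substituted (x1 - x)^K f is
    independent of K once K is large, and after multiplication by (x1 - x2)^m a single exponent
    serves for all modes. *)

Section IntegerSums.
Variables (R : realType) (W : lmodType R[i]).
Implicit Types f g : int -> W.

(** A finitely supported sum takes the value 0 when the support is infinite. Hence additivity below
    asks for [zfin], while reindexing does not. *)
Definition zsum f : W := \sum_(a \in [set: int]) f a.

Definition zfin f := exists N : nat, forall a : int,
  a < - N%:Z \/ N%:Z <= a -> f a = 0.

Lemma zsumE (N : nat) f : (forall a : int, a < - N%:Z \/ N%:Z <= a -> f a = 0) ->
  zsum f = \sum_(i < N + N) f (i%:Z - N%:Z).
Proof.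
move=> fN; rewrite /zsum -(big_mkord xpredT (fun i => f (i%:Z - N%:Z))).
have uq : uniq [seq (i%:Z - N%:Z) | i <- iota 0 (N + N)].
  by rewrite map_inj_uniq ?iota_uniq// => x y; lia.
rewrite -(big_map (fun i : nat => i%:Z - N%:Z) xpredT f).
rewrite /index_iota subn0 (fsbigE [seq (i%:Z - N%:Z) | i <- iota 0 (N + N)]) //.
  by apply: eq_bigl => a; rewrite in_setT.
move=> a _ /negP na; apply: fN.
have [lt1|ge1] := ltP a (- N%:Z); first by left.
have [ge2|lt2] := leP N%:Z a; first by right.
case: na; apply/mapP; exists `|(a + N%:Z)%R|%N; last by lia.
by rewrite mem_iota; lia.
Qed.

Lemma zfinW (N M : nat) f : (N <= M)%N ->
  (forall a : int, a < - N%:Z \/ N%:Z <= a -> f a = 0) ->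
  (forall a : int, a < - M%:Z \/ M%:Z <= a -> f a = 0).
Proof. by move=> NM fN a aM; apply: fN; lia. Qed.

Lemma eq_zsum f g : f =1 g -> zsum f = zsum g.
Proof. by move=> /funext ->. Qed.

Lemma zsum0 : zsum (fun=> 0) = 0.
Proof. by rewrite /zsum fsbig1. Qed.

Lemma zsumD f g : zfin f -> zfin g ->
  zsum (fun a => f a + g a) = zsum f + zsum g.
Proof.
move=> [N fN] [M gM].
have fN' := zfinW (leq_maxl N M) fN; have gM' := zfinW (leq_maxr N M) gM.
rewrite (zsumE fN') (zsumE gM') (@zsumE (maxn N M)) ?big_split// => a aM.
by rewrite fN'// gM'// addr0.
Qed.

Lemma zsumZ c f : zfin f -> zsum (fun a => c *: f a) = c *: zsum f.
Proof.
move=> [N fN]; rewrite (zsumE fN) (@zsumE N) ?scaler_sumr// => a aN.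
by rewrite fN// scaler0.
Qed.

Lemma zsumN f : zfin f -> zsum (fun a => - f a) = - zsum f.
Proof.
move=> fN; rewrite -scaleN1r -zsumZ//.
by apply: eq_zsum => a; rewrite scaleN1r.
Qed.

Lemma zfinN f : zfin f -> zfin (fun a => - f a).
Proof. by move=> [N fN]; exists N => a aN; rewrite fN// oppr0. Qed.

Lemma zsumB f g : zfin f -> zfin g ->
  zsum (fun a => f a - g a) = zsum f - zsum g.
Proof. by move=> ff fg; rewrite zsumD ?zsumN//; exact: zfinN. Qed.

Lemma zsum_shift c f : zsum (fun a => f (a + c)) = zsum f.
Proof.
rewrite /zsum [RHS](@reindex_fsbigT _ _ _ _ _ (fun a : int => a + c))//.
by exists (fun a => a - c) => a; rewrite ?addrK ?subrK.
Qed.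

Lemma zsum_refl c f : zsum (fun a => f (c - a)) = zsum f.
Proof.
rewrite /zsum [RHS](@reindex_fsbigT _ _ _ _ _ (fun a : int => c - a))//.
by exists (fun a => c - a) => a; rewrite subKr.
Qed.

Lemma zsum1 a0 f : (forall a, a != a0 -> f a = 0) -> zsum f = f a0.
Proof.
move=> f0; rewrite /zsum (fsbigE [:: a0])//=.
  by rewrite big_cons big_nil in_setT addr0.
by move=> a _; rewrite inE; exact: f0.
Qed.

Lemma zsum_exch (F : int -> int -> W) :
  (exists N : nat, forall a b : int,
    (a < - N%:Z \/ N%:Z <= a) \/ (b < - N%:Z \/ N%:Z <= b) -> F a b = 0) ->
  zsum (fun a => zsum (F a)) = zsum (fun b => zsum (F^~ b)).
Proof.
move=> [N FN].
rewrite (@zsumE N); last first.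
  by move=> a aN; rewrite (_ : F a = fun=> 0) ?zsum0//; apply/funext => b; apply: FN; left.
rewrite (@zsumE N); last first.
  by move=> b bN; rewrite (_ : F^~ b = fun=> 0) ?zsum0//; apply/funext => a; apply: FN; right.
transitivity (\sum_(i < N + N) \sum_(j < N + N) F (i%:Z - N%:Z) (j%:Z - N%:Z)).
  by apply: eq_bigr => i _; rewrite (@zsumE N)// => *; apply: FN; right.
rewrite exchange_big /=; apply: eq_bigr => i _.
by rewrite (@zsumE N)// => *; apply: FN; left.
Qed.

Lemma zsum_nat (f : int -> W) : (forall n, f (Negz n) = 0) ->
  zsum f = \sum_(j \in [set: nat]) f j%:Z.
Proof.
move=> f0; rewrite /zsum -(@fsbig_image _ _ _ nat int setT Posz f); last first.
  by move=> x y _ _ [].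
apply/esym/fsbig_widen => // a [_ /= na]; case: a na => [n []|n _]//.
by exists n.
Qed.

End IntegerSums.

Lemma zsum_lin (R : realType) (W W' : lmodType R[i]) (L : W -> W') (f : int -> W) :
  linear L -> zfin f -> L (zsum f) = zsum (L \o f).
Proof.
move=> linL [N fN].
have LD x y : L (x + y) = L x + L y by rewrite -[x]scale1r linL !scale1r.
have L0 : L 0 = 0 by apply: (@addrI _ (L 0)); rewrite -LD !addr0.
rewrite (zsumE fN) (@zsumE _ _ N) => [|a aN /=]; last by rewrite fN.
exact: (big_morph L LD L0).
Qed.

(** * Binomial coefficients with complex upper and integer lower argument *)

Section Binomials.
Variable R : realType.
Local Notation C := R[i].
Implicit Types (x y : C) (i j n : int).

(** Extended by 0 to negative lower indices, so that sums over all integers can be shifted and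
    reflected without boundary terms. *)
Definition binomz x i : C := if i is Posz j then binom x j else 0.

Lemma binomS x (j : nat) : j.+1%:R * binom x j.+1 = (x - j%:R) * binom x j.
Proof.
rewrite /binom big_ord_recr /= factS natrM invfM.
rewrite [LHS]mulrC -!mulrA [_^-1 * (_^-1 * _)]mulrCA mulVf ?pnatr_eq0//.
by rewrite mulr1 [LHS]mulrC mulrA mulrAC mulrC.
Qed.

Lemma binom0 x : binom x 0 = 1.
Proof. by rewrite /binom big_ord0 fact0 divr1. Qed.

Lemma binomz0 x : binomz x 0 = 1.
Proof. exact: binom0. Qed.

Lemma binomz_neg x i : i < 0 -> binomz x i = 0.
Proof. by case: i. Qed.

Lemma binomzS x i : (i + 1)%:~R * binomz x (i + 1) = (x - i%:~R) * binomz x i.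
Proof.
case: i => [j|[|j]]; last 2 first.
- by rewrite /= mulr0 mul0r.
- by rewrite !binomz_neg ?mulr0//; lia.
by rewrite -PoszD addn1 /= -binomS.
Qed.

(** The identities below compare their two sides through the recurrence in the lower index, which
    determines binom(x, i) from binom(x, i - 1) when [i] is nonzero. *)
Lemma binomz_rec x i (y : C) : i != 0 ->
  i%:~R * y = (x - (i - 1)%:~R) * binomz x (i - 1) -> y = binomz x i.
Proof.
move=> i0; rewrite -binomzS subrK => e.
by apply: mulfI e; rewrite intr_eq0.
Qed.

Lemma int_ind0 (P : int -> Prop) : (forall i, i < 0 -> P i) ->
  (forall i, 0 <= i -> P (i - 1) -> P i) -> forall i, P i.
Proof.
move=> Pneg PS [j|j]; last exact: Pneg.
elim: j => [|j IH]; first by apply: PS => //; apply: Pneg.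
by apply: PS => //; rewrite (_ : j.+1%:Z - 1 = j)//; lia.
Qed.

Lemma binomz_pascal x i : binomz (x + 1) i = binomz x i + binomz x (i - 1).
Proof.
elim/int_ind0: i => [i i0|i i0 IH]; first by rewrite !binomz_neg ?addr0//; lia.
have [->|i0'] := eqVneq i 0; first by rewrite !binomz0 addr0.
apply/esym; apply: binomz_rec => //; rewrite IH.
have e1 := binomzS x (i - 1); have e2 := binomzS x (i - 1 - 1).
rewrite !subrK in e1 e2.
rewrite mulrDr e1 [RHS]mulrDr.
have -> : (x + 1 - (i - 1)%:~R) * binomz x (i - 1 - 1)
   = (x - (i - 1 - 1)%:~R) * binomz x (i - 1 - 1) by ring.
by rewrite -e2; ring.
Qed.

Lemma binomz_absorb x i : x * binomz (x - 1) i = (x - i%:~R) * binomz x i.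
Proof.
elim/int_ind0: i => [i i0|i i0 IH]; first by rewrite !binomz_neg ?mulr0//; lia.
have [->|i0'] := eqVneq i 0; first by rewrite !binomz0 subr0.
apply: (@mulfI _ i%:~R); first by rewrite intr_eq0.
have e1 := binomzS x (i - 1); have e2 := binomzS (x - 1) (i - 1).
rewrite !subrK in e1 e2.
rewrite mulrCA e2 mulrCA IH [RHS]mulrCA e1; ring.
Qed.

Lemma binomz_nat (n i : int) : 0 <= n < i -> binomz n%:~R i = 0 :> C.
Proof.
case: n i => [n|//] [i|//] /= ni.
by rewrite -[_%:~R]/(n%:R) binom_nat bin_small//; lia.
Qed.

Lemma binomz_sym (n i : int) : 0 <= n -> binomz n%:~R i = binomz n%:~R (n - i) :> C.
Proof.
move=> n0; have [i0|i0] := ltP i 0; first by rewrite binomz_neg// binomz_nat//; lia.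
have [ni|ni] := ltP n i; first by rewrite [RHS]binomz_neg ?binomz_nat//; lia.
case: n n0 ni => [n|//] _; case: i i0 => [i|//] _ ni.
have {}ni : (i <= n)%N by lia.
by rewrite subzn//= -[_%:~R]/(n%:R) !binom_nat bin_sub.
Qed.

(** Expanding a power of x + z2 + z0 first in z0 and then in z2 gives the left product; expanding it
    in z0 + z2 gives the right one. *)
Lemma binomz_trinomial x (s c : int) : 0 <= s ->
  binomz x s * binomz (x - s%:~R) c = binomz (s + c)%:~R s * binomz x (s + c).
Proof.
move=> s0; elim/int_ind0: c => [c c0|c c0 IH].
  rewrite (binomz_neg _ c0) mulr0; have [sc|sc] := ltP (s + c) 0.
    by rewrite (binomz_neg _ sc) mulr0.
  by rewrite binomz_nat ?mul0r//; lia.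
have [->|c0'] := eqVneq c 0.
  rewrite addr0 binomz0 mulr1 binomz_sym// subrr binomz0 mul1r//.
apply: (@mulfI _ c%:~R); first by rewrite intr_eq0.
have e1 := binomzS (x - s%:~R) (c - 1); rewrite subrK in e1.
rewrite mulrCA e1.
transitivity ((x - (s + c - 1)%:~R) * (binomz x s * binomz (x - s%:~R) (c - 1))); first by ring.
rewrite IH addrA.
have e2 := binomzS x (s + c - 1); rewrite subrK in e2.
rewrite mulrCA -e2.
have e3 := binomz_absorb (s + c)%:~R s.
have -> : (s + c - 1)%:~R = (s + c)%:~R - 1 :> C by ring.
transitivity ((s + c)%:~R * binomz ((s + c)%:~R - 1) s * binomz x (s + c)); first by ring.
by rewrite e3; ring.
Qed.

Lemma sgnzS i : (-1) ^ (i + 1) = - (-1) ^ i :> C.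
Proof. by rewrite exprzDr ?unitrN1// expr1z mulrN1. Qed.

Lemma sgnzN i : (-1) ^ (- i) = (-1) ^ i :> C.
Proof. by rewrite -exprz_inv invrN1. Qed.

(** The hypothesis [0 <= s + c] keeps out the indices at which the left side is 0 while binom(s + c,
    s) is not. *)
Lemma binomz_opp (s c : int) : 0 <= s -> 0 <= s + c ->
  (-1) ^ c * binomz (- s - 1)%:~R c = binomz (s + c)%:~R s :> C.
Proof.
move=> s0; elim/int_ind0: c => [c c0 sc|c c0 IH sc].
  by rewrite (binomz_neg _ c0) mulr0 binomz_nat//; lia.
have [->|c0'] := eqVneq c 0.
  by rewrite expr0z binomz0 mul1r addr0 binomz_sym// subrr binomz0.
apply: (@mulfI _ c%:~R); first by rewrite intr_eq0.
have e1 := binomzS (- s - 1)%:~R (c - 1); rewrite subrK in e1.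
rewrite mulrCA e1 -{1}(subrK 1 c) sgnzS.
transitivity ((s + c)%:~R * ((-1) ^ (c - 1) * binomz (- s - 1)%:~R (c - 1)) : C).
  by ring.
rewrite IH; last by lia.
have := binomz_absorb (s + c)%:~R s.
have -> : (s + (c - 1))%:~R = (s + c)%:~R - 1 :> C by ring.
by move=> ->; ring.
Qed.

Lemma zfin_binom (W : lmodType C) x (f : int -> W) :
  (exists N : int, forall a, N <= a -> f a = 0) ->
  zfin (fun a => binomz x a *: f a).
Proof.
move=> [N fN]; exists `|N|%N => a [a0|a0]; last by rewrite fN ?scaler0//; lia.
by rewrite binomz_neg ?scale0r//; lia.
Qed.

Lemma zsum_vandermonde x y i :
  zsum (fun j => binomz x j *: (binomz y (i - j) : C^o)) = binomz (x + y) i.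
Proof.
have fin z t k : zfin (fun j => (z + t * j%:~R) *: (binomz x j *: (binomz y (k - j) : C^o))).
  exists (absz k + 1)%N => a [a0|a0]; first by rewrite binomz_neg ?scale0r ?scaler0//; lia.
  by rewrite (binomz_neg y) ?scaler0//; lia.
have fin0 k : zfin (fun j => binomz x j *: (binomz y (k - j) : C^o)).
  have [N fN] := fin 1 0 k; exists N => a /fN; rewrite mul0r addr0 scale1r//.
elim/int_ind0: i => [i i0|i i0 IH].
  rewrite binomz_neg// -[RHS](zsum0 C^o); apply: eq_zsum => a.
  have [a0|a0] := ltP a 0; first by rewrite binomz_neg ?scale0r.
  by rewrite (binomz_neg y) ?scaler0//; lia.
have [->|i0'] := eqVneq i 0.
  rewrite (@zsum1 _ _ 0) ?subrr ?binomz0 ?scale1r// => a a0.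
  have [a1|a1] := ltP a 0; first by rewrite binomz_neg ?scale0r.
  by rewrite (binomz_neg y) ?scaler0//; lia.
apply: binomz_rec => //; rewrite -IH.
(* Split the factor i as j + (i - j) and let each part meet the binomial whose recurrence absorbs
   it; the first sum is then shifted by 1. *)
transitivity (zsum (fun j : int => ((0 + 1 * j%:~R) *: (binomz x j *: (binomz y (i - j) : C^o))))
   + zsum (fun j : int => ((i%:~R + (-1) * j%:~R) *: (binomz x j *: (binomz y (i - j) : C^o))))).
  have f1 := fin 0 1 i; have f2 := fin i%:~R (-1) i.
  rewrite -(zsumD f1 f2).
  rewrite -[LHS](zsumZ i%:~R (fin0 i)); apply: eq_zsum => j.
  by rewrite -scalerDl; congr (_ *: _); ring.
rewrite -[X in X + _](zsum_shift 1).
rewrite -[RHS](zsumZ _ (fin0 (i - 1))).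
rewrite -zsumD//; last first.
  have [N fN] := fin 0 1 i; exists (N + 1)%N => a aN; apply: fN; lia.
apply: eq_zsum => j.
rewrite /GRing.scale /= mulrA.
rewrite add0r mul1r binomzS (_ : i - (j + 1) = i - 1 - j); last by lia.
have e1 := binomzS y (i - 1 - j).
rewrite (_ : i - 1 - j + 1 = i - j) in e1; last by lia.
have -> : i%:~R + -1 * j%:~R = (i - j)%:~R :> C by ring.
rewrite [X in _ + X]mulrCA e1; ring.
Qed.

(* The difference of the two expansions of [(x1 - x2)^n] is, for [n < 0], a
   derivative of the delta function. *)
Lemma binomz_delta n j :
  (-1) ^ j * (binomz n%:~R j - binomz n%:~R (n - j)) = binomz (j - n - 1)%:~R (- n - 1) :> C.
Proof.
have nonneg m k : 0 <= m ->
    (-1) ^ k * (binomz m%:~R k - binomz m%:~R (m - k)) = binomz (k - m - 1)%:~R (- m - 1) :> C.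
  by move=> m0; rewrite -binomz_sym// subrr mulr0 binomz_neg//; lia.
have [/nonneg//|n0] := leP 0 n.
have -> : n = - (`|(n + 1)%R|%N)%:Z - 1 by lia.
elim: `|(n + 1)%R|%N j => {n n0} [|m IH] j.
  rewrite (_ : - 0%:Z - 1 = -1); last by lia.
  rewrite (_ : j - -1 - 1 = j); last by lia.
  rewrite (_ : - -1 - 1 = 0 :> int); last by lia.
  rewrite binomz0.
  have neg1 i : 0 <= i -> (-1) ^ i * binomz (-1)%:~R i = 1 :> C.
    by move=> i0; rewrite (binomz_opp (s := 0))// ?add0r ?binomz0.
  have [j0|j0] := leP 0 j.
    by rewrite [X in _ - X]binomz_neg ?subr0 ?neg1//; lia.
  rewrite [X in X - _]binomz_neg// sub0r.
  have -> : (-1) ^ j = - (-1) ^ (-1 - j) :> C.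
    by rewrite -sgnzS (_ : -1 - j + 1 = - j) ?sgnzN//; lia.
  by rewrite mulrNN neg1//; lia.
set n : int := - m%:Z - 1 in IH *.
have -> : - m.+1%:Z - 1 = n - 1 by rewrite /n; lia.
(* The defect at exponent n - 1. Pascal's rule and the case n show that it does not depend on k, and
   at k = -1 its three binomials vanish. *)
pose g k : C := (-1) ^ k * (binomz (n - 1)%:~R k - binomz (n - 1)%:~R (n - 1 - k))
  - binomz (k - (n - 1) - 1)%:~R (- (n - 1) - 1).
suff g0 : g j = 0 by apply/eqP; rewrite -subr_eq0; apply/eqP; exact: g0.
have gS k : g k = g (k - 1).
  apply/eqP; rewrite -subr_eq0; apply/eqP.
  have nE : n%:~R = (n - 1)%:~R + 1 :> C by ring.
  have := IH k; rewrite nE !binomz_pascal /g.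
  rewrite (_ : (k - (n - 1) - 1)%:~R = (k - n - 1)%:~R + 1 :> C); last by ring.
  rewrite binomz_pascal.
  rewrite (_ : n - 1 - (k - 1) = n - k); last by lia.
  rewrite (_ : n - k - 1 = n - 1 - k); last by lia.
  rewrite (_ : k - 1 - (n - 1) - 1 = k - n - 1); last by lia.
  rewrite (_ : - (n - 1) - 1 - 1 = - n - 1); last by lia.
  have := sgnzS (k - 1); rewrite subrK => -> <-; ring.
have gc k : g k = g (-1).
  have gn (i : nat) : g (i%:Z - 1) = g (-1) /\ g (- i%:Z - 1) = g (-1).
    elim: i => [|i [IH1 IH2]]; first by [].
    split; first by rewrite -IH1 gS; congr g; lia.
    by rewrite -IH2 [RHS]gS; congr g; lia.
  have [k0|k0] := leP 0 (k + 1).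
    have := (gn `|(k + 1)%R|%N).1; congr (g _ = _); lia.
  have := (gn `|(k + 1)%R|%N).2; congr (g _ = _); lia.
rewrite gc /g (binomz_neg _ (_ : -1 < 0))// [binomz _ (n - 1 - -1)]binomz_neg; last by rewrite /n; lia.
by rewrite binomz_nat ?subrr ?mulr0 ?subrr//; rewrite /n; lia.
Qed.

End Binomials.

(** * Series in two variables *)

Section Lattice.
Variables (R : realType) (W : lmodType R[i]).
Local Notation C := R[i].
Implicit Types (f g F : int -> int -> W) (a b c n : int) (rho : C).

(* [f a b] stands for the coefficient of [x1^(-a-1-rho) x^(-b-1-beta)]: the modes
   are counted from fixed offsets, so that the exponents range over the integers. *)
Definition trl f := exists N : int, forall a b, N <= a -> f a b = 0.
Definition trr f := exists N : int, forall a b, N <= b -> f a b = 0.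
(** Large modes are low powers, so this says that the series is bounded below in both variables, the
    condition under which x1 may be replaced by x + z. *)
Definition bt f := exists N : int, forall a b, N <= a \/ N <= b -> f a b = 0.

Lemma bt_trlr f : trl f -> trr f -> bt f.
Proof.
move=> [N fN] [M fM]; exists (Num.max N M) => a b [h|h].
  by apply: fN; lia.
by apply: fM; lia.
Qed.

Lemma bt_trl f : bt f -> trl f.
Proof. by move=> [N fN]; exists N => a b h; apply: fN; left. Qed.

Lemma bt_trr f : bt f -> trr f.
Proof. by move=> [N fN]; exists N => a b h; apply: fN; right. Qed.

(* Multiplication by [x1 - x]. *)
Definition latdif f a b : W := f (a + 1) b - f a (b + 1).

Lemma trl_ldif f : trl f -> trl (latdif f).
Proof. by move=> [N fN]; exists N => a b h; rewrite /latdif !fN ?subrr//; lia. Qed.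

Lemma trr_ldif f : trr f -> trr (latdif f).
Proof. by move=> [N fN]; exists N => a b h; rewrite /latdif !fN ?subrr//; lia. Qed.

Lemma trl_iter k f : trl f -> trl (iter k latdif f).
Proof. by move=> ff; elim: k => //= k; exact: trl_ldif. Qed.

Lemma trr_iter k f : trr f -> trr (iter k latdif f).
Proof. by move=> ff; elim: k => //= k; exact: trr_ldif. Qed.

Lemma bt_iter k f : bt f -> bt (iter k latdif f).
Proof. by move=> bf; apply: bt_trlr; [apply/trl_iter/bt_trl|apply/trr_iter/bt_trr]. Qed.

Lemma btD f g : bt f -> bt g -> bt (fun a b => f a b + g a b).
Proof.
move=> [N fN] [M gM]; exists (Num.max N M) => a b h.
by rewrite fN ?gM ?addr0//; lia.
Qed.

Lemma btN f : bt f -> bt (fun a b => - f a b).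
Proof. by move=> [N fN]; exists N => a b h; rewrite fN ?oppr0. Qed.

Lemma btB f g : bt f -> bt g -> bt (fun a b => f a b - g a b).
Proof. by move=> bf bg; apply: btD => //; exact: btN. Qed.

Lemma iter_ldifD k f g a b :
  iter k latdif (fun a b => f a b + g a b) a b = iter k latdif f a b + iter k latdif g a b.
Proof.
elim: k a b => [//|k IH] a b; rewrite !iterS /latdif !IH.
by rewrite opprD addrACA.
Qed.

Lemma iter_ldifB k f g a b :
  iter k latdif (fun a b => f a b - g a b) a b = iter k latdif f a b - iter k latdif g a b.
Proof.
elim: k a b => [//|k IH] a b; rewrite !iterS /latdif !IH.
by rewrite !opprD !opprK addrACA.
Qed.

(** Multiplication by sum_j [u n j] x1^{n-j} x^j. Both expansions of (x1 - x)^n have this form, so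
    their common properties are proved once. *)
Definition zconv (u : int -> int -> C) n F a b : W :=
  zsum (fun j => u n j *: F (a + n - j) (b + j)).

Lemma zconv_ldif u n F a b :
  (forall a b, zfin (fun j => u n j *: F (a + n - j) (b + j))) ->
  zconv u n (latdif F) a b = zconv u n F (a + 1) b - zconv u n F a (b + 1).
Proof.
move=> fin; rewrite /zconv -zsumB//; apply: eq_zsum => j.
by rewrite /latdif scalerBr; congr (_ *: F _ _ - _ *: F _ _); lia.
Qed.

Lemma zconvS u n F a b : (forall j, u (n + 1) j = u n j - u n (j - 1)) ->
  (forall a b, zfin (fun j => u n j *: F (a + n - j) (b + j))) ->
  zconv u (n + 1) F a b = zconv u n F (a + 1) b - zconv u n F a (b + 1).
Proof.
move=> uS fin; rewrite /zconv -[X in _ - X](zsum_shift (-1)) -zsumB//; last first.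
  have [N fN] := fin a (b + 1); exists N.+1 => j jN; apply: fN; lia.
apply: eq_zsum => j; rewrite uS scalerBl.
by congr (_ *: F _ _ - _ *: F _ _); lia.
Qed.

(* Coefficients of [(x1 - x)^n] and of [(- x + x1)^n], indexed by the power of [x]. *)
Definition mulz_l n j : C := (-1) ^ j * binomz n%:~R j.
Definition mulz_r n j : C := (-1) ^ j * binomz n%:~R (n - j).

Lemma mulz_lS n j : mulz_l (n + 1) j = mulz_l n j - mulz_l n (j - 1).
Proof.
rewrite /mulz_l (_ : (n + 1)%:~R = n%:~R + 1 :> C); last by ring.
rewrite binomz_pascal; have := sgnzS R (j - 1); rewrite subrK => ->; ring.
Qed.

Lemma mulz_rS n j : mulz_r (n + 1) j = mulz_r n j - mulz_r n (j - 1).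
Proof.
rewrite /mulz_r (_ : (n + 1)%:~R = n%:~R + 1 :> C); last by ring.
rewrite binomz_pascal (_ : n + 1 - j - 1 = n - j); last by lia.
rewrite (_ : n - (j - 1) = n + 1 - j); last by lia.
have := sgnzS R (j - 1); rewrite subrK => ->; ring.
Qed.

Lemma mulz_l_fin n F a b : trr F ->
  zfin (fun j => mulz_l n j *: F (a + n - j) (b + j)).
Proof.
move=> [N fN]; exists (absz N + absz b + 1)%N => j [j0|j0].
  by rewrite /mulz_l binomz_neg ?mulr0 ?scale0r//; lia.
by rewrite fN ?scaler0//; lia.
Qed.

Lemma mulz_r_fin n F a b : trl F ->
  zfin (fun j => mulz_r n j *: F (a + n - j) (b + j)).
Proof.
move=> [N fN]; exists (absz N + absz a + absz n + 1)%N => j [j0|j0].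
  by rewrite fN ?scaler0//; lia.
by rewrite /mulz_r binomz_neg ?mulr0 ?scale0r//; lia.
Qed.

Definition mulz := zconv mulz_l.
Definition mulz' := zconv mulz_r.

(** Since [n] may be negative, multiplication by a power of x1 - x can be undone and loses no
    information. *)
Lemma mulz_iter k n F a b : trr F -> mulz n (iter k latdif F) a b = mulz (n + k%:Z) F a b.
Proof.
move=> tF; elim: k n a b => [|k IH] n a b; first by rewrite addr0.
have tk := trr_iter k tF.
rewrite iterS /mulz zconv_ldif; last by move=> *; apply: mulz_l_fin.
rewrite -zconvS; [|exact: mulz_lS|by move=> *; apply: mulz_l_fin].
by rewrite -/mulz IH; congr (mulz _ _ _ _); lia.
Qed.

Lemma mulz'_iter k n F a b : trl F -> mulz' n (iter k latdif F) a b = mulz' (n + k%:Z) F a b.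
Proof.
move=> tF; elim: k n a b => [|k IH] n a b; first by rewrite addr0.
have tk := trl_iter k tF.
rewrite iterS /mulz' zconv_ldif; last by move=> *; apply: mulz_r_fin.
rewrite -zconvS; [|exact: mulz_rS|by move=> *; apply: mulz_r_fin].
by rewrite -/mulz' IH; congr (mulz' _ _ _ _); lia.
Qed.

Lemma mulz_mulz' n F : 0 <= n -> mulz n F = mulz' n F.
Proof.
move=> n0; apply/funext => a; apply/funext => b; apply: eq_zsum => j.
by rewrite /mulz_l /mulz_r -binomz_sym.
Qed.

Lemma mulz0 F : mulz 0 F = F.
Proof.
apply/funext => a; apply/funext => b; rewrite /mulz /zconv (@zsum1 _ _ 0).
  by rewrite /mulz_l binomz0 expr0z mul1r scale1r !addr0.
move=> j j0; rewrite /mulz_l; have [j1|j1] := ltP j 0.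
  by rewrite binomz_neg// mulr0 scale0r.
by rewrite binomz_nat ?mulr0 ?scale0r//; lia.
Qed.

Lemma mulz_nat (k : nat) F : trr F -> mulz k%:Z F = iter k latdif F.
Proof.
move=> tF; apply/funext => a; apply/funext => b.
by rewrite -[in RHS](mulz0 (iter k latdif F)) mulz_iter// add0r.
Qed.

Lemma mulz'_nat (k : nat) F : trl F -> mulz' k%:Z F = iter k latdif F.
Proof.
move=> tF; apply/funext => a; apply/funext => b.
by rewrite -[in RHS](mulz0 (iter k latdif F)) mulz_mulz'// mulz'_iter// add0r.
Qed.

Lemma mulz_delta n f a b : bt f ->
  mulz n f a b - mulz' n f a b
  = zsum (fun j => binomz (j - n - 1)%:~R (- n - 1) *: f (a + n - j) (b + j)).
Proof.
move=> bf; rewrite /mulz /mulz' /zconv -zsumB; last 2 first.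
- by apply: mulz_l_fin; exact: bt_trr.
- by apply: mulz_r_fin; exact: bt_trl.
by apply: eq_zsum => j; rewrite -scalerBl /mulz_l /mulz_r -mulrBr binomz_delta.
Qed.

(* With the convention that [f a b] is the coefficient of
   [x1^(-a-1-rho) x^(-b-1-beta)], this is the coefficient of
   [z^i x^(-c-1-rho-beta)] in [f(x + z, x)]. *)
Definition diag rho (i : int) f c : W :=
  zsum (fun a => binomz (- a%:~R - 1 - rho) i *: f a (c - 1 - i - a)).

Lemma diag_fin (u : int -> C) c f : bt f -> zfin (fun a => u a *: f a (c - a)).
Proof.
move=> [N fN]; exists (absz N + absz c + 1)%N => a h.
by rewrite fN ?scaler0//; lia.
Qed.

Lemma diag_neg rho i f c : i < 0 -> diag rho i f c = 0.
Proof.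
move=> i0; rewrite -[RHS](zsum0 W); apply: eq_zsum => a.
by rewrite binomz_neg// scale0r.
Qed.

Lemma diagB rho i f g c : bt f -> bt g ->
  diag rho i (fun a b => f a b - g a b) c = diag rho i f c - diag rho i g c.
Proof.
move=> bf bg; rewrite -zsumB; try exact: diag_fin.
by apply: eq_zsum => a; rewrite scalerBr.
Qed.

Lemma diagD rho i f g c : bt f -> bt g ->
  diag rho i (fun a b => f a b + g a b) c = diag rho i f c + diag rho i g c.
Proof.
move=> bf bg; rewrite -zsumD; try exact: diag_fin.
by apply: eq_zsum => a; rewrite scalerDr.
Qed.

Lemma diag_next rho i f c : diag rho i (fun a b => f a (b + 1)) c = diag rho i f (c + 1).
Proof. by apply: eq_zsum => a; congr (_ *: f _ _); lia. Qed.

(** An integer moved from the mode index into the offset. This is how a residue r %% T is exchanged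
    for r itself. *)
Lemma diag_offset rho (q : int) i f c :
  diag (rho + q%:~R) i (fun a b => f (a + q) b) c = diag rho i f (c + q).
Proof.
rewrite -[RHS](zsum_shift q); apply: eq_zsum => a.
congr (binomz _ _ *: f _ _); [ring|lia].
Qed.

Lemma diag_trunc rho i f N : (forall a b, N <= a \/ N <= b -> f a b = 0) ->
  forall c, N + N + 1 + i <= c -> diag rho i f c = 0.
Proof.
move=> fN c h; rewrite -[RHS](zsum0 W); apply: eq_zsum => a.
by rewrite fN ?scaler0//; lia.
Qed.

(** Under x1 = x + z the factor x1 - x becomes z, which lowers the extracted order by one; on
    coefficients this is Pascal's rule. *)
Lemma diag_ldif rho i f c : bt f -> diag rho i (latdif f) c = diag rho (i - 1) f c.
Proof.
move=> bf; rewrite /diag.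
transitivity (zsum (fun a => binomz (- a%:~R - 1 - rho) i *: f (a + 1) (c - i - (a + 1)))
   - zsum (fun a => binomz (- a%:~R - 1 - rho) i *: f a (c - i - a))).
  rewrite -zsumB; last exact: diag_fin.
    apply: eq_zsum => a; rewrite -scalerBr /latdif.
    by congr (_ *: (f _ _ - f _ _)); lia.
  have [N fN] := bf; exists (absz N + absz c + absz i + 2)%N => a h.
  by rewrite fN ?scaler0//; lia.
rewrite -[X in X - _](zsum_shift (-1)) -zsumB; last first.
- exact: diag_fin.
- have [N fN] := bf; exists (absz N + absz c + absz i + 3)%N => a h.
  by rewrite fN ?scaler0//; lia.
apply: eq_zsum => a; rewrite subrK -scalerBl.
rewrite (_ : - (a - 1)%:~R - 1 - rho = (- a%:~R - 1 - rho) + 1); last by ring.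
rewrite binomz_pascal [X in X - _]addrC addrK; congr (_ *: f _ _); lia.
Qed.

Lemma diag_iter rho i k f c : bt f ->
  diag rho i (iter k latdif f) c = diag rho (i - k%:Z) f c.
Proof.
move=> bf; elim: k i => [|k IH] i; first by rewrite subr0.
rewrite iterS diag_ldif ?IH; first by congr diag; lia.
exact: bt_iter.
Qed.

(** The derivative of f(x + z, x) in x is the substituted sum of the two partial derivatives of f.
    On coefficients the identity reduces to [binomz_absorb]. *)
Lemma diag_deriv rho beta i f c : bt f ->
  diag rho i (fun a b => - (a%:~R + rho) *: f (a - 1) b
    - (b%:~R + beta) *: f a (b - 1)) c
  = - (c%:~R + (rho + beta)) *: diag rho i f (c - 1).
Proof.
move=> bf; have [N fN] := bf.
rewrite diagB; last 2 first.
- by exists (N + 1) => a b h; rewrite fN ?scaler0//; lia.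
- by exists (N + 1) => a b h; rewrite fN ?scaler0//; lia.
rewrite /diag -[X in X - _](zsum_shift 1) -zsumB; last 2 first.
- exists (absz N + absz c + absz i + 3)%N => a h.
  by rewrite fN ?scaler0//; lia.
- exists (absz N + absz c + absz i + 3)%N => a h.
  by rewrite fN ?scaler0//; lia.
rewrite -zsumZ; last exact: diag_fin.
apply: eq_zsum => a; rewrite addrK !scalerA.
rewrite (_ : c - 1 - i - (a + 1) = c - 1 - 1 - i - a); last by lia.
rewrite (_ : c - 1 - i - a - 1 = c - 1 - 1 - i - a); last by lia.
rewrite -scalerBl; congr (_ *: _).
have e := binomz_absorb (- a%:~R - 1 - rho) i.
set y := - a%:~R - 1 - rho in e *.
rewrite (_ : - (a + 1)%:~R - 1 - rho = y - 1); last by rewrite /y; ring.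
have -> : (c - 1 - i - a)%:~R + beta = (c%:~R + (rho + beta)) + (y - i%:~R) by rewrite /y; ring.
have -> : - ((a + 1)%:~R + rho) = y by rewrite /y; ring.
by rewrite mulrC e; ring.
Qed.

(** The left side is the residue that defines u_n^H; the right side is the coefficient of z^{-n-1}
    in z^{-k} f(x + z, x). Dividing the common series f by powers of x1 - x in both expansions
    leaves a derivative of the delta function, which performs the substitution for integral
    exponents. The sum over j with binom(-rho, j) supplies the missing power (x + z)^{-rho} by
    Vandermonde's identity. *)
Lemma residue_diag rho n (k : nat) A B c : trr A -> trl B ->
  iter k latdif A = iter k latdif B ->
  zsum (fun j => binomz (- rho) j *: (mulz (n + j) A 0 (c - j) - mulz' (n + j) B 0 (c - j)))
  = diag rho (k%:Z - n - 1) (iter k latdif A) c.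
Proof.
move=> tA tB AB; set f := iter k latdif A.
have bf : bt f.
  by apply: bt_trlr; [rewrite /f AB; exact: trl_iter|exact: trr_iter].
have [N fN] := bf; set i := k%:Z - n - 1.
transitivity (zsum (fun j => zsum (fun a =>
   binomz (- rho) j *: (binomz (- a%:~R - 1) (i - j) *: f a (c - 1 - i - a))))).
  apply: eq_zsum => j; rewrite -[n + j](subrK k%:Z).
  rewrite -mulz_iter// -mulz'_iter// -AB -/f mulz_delta//.
  rewrite zsumZ; last exact: diag_fin.
  congr (_ *: _); rewrite -[LHS](zsum_refl (n + j - k%:Z)); apply: eq_zsum => a.
  congr (binomz _ _ *: f _ _); rewrite /i; try lia.
  rewrite (_ : n + j - k%:Z - a - (n + j - k%:Z) - 1 = - a - 1); last by lia.
  by ring.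
rewrite zsum_exch; last first.
  exists (absz N + absz c + absz i + 2)%N => j a [j0|a0].
    have [j1|j1] := ltP j 0; first by rewrite binomz_neg ?scale0r.
    by rewrite [binomz (_ - _) _]binomz_neg ?scale0r ?scaler0//; lia.
  by rewrite fN ?scaler0//; lia.
apply: eq_zsum => a; rewrite (_ : - a%:~R - 1 - rho = - rho + (- a%:~R - 1)); last by ring.
rewrite -zsum_vandermonde.
rewrite (zsum_lin (L := fun x : C^o => x *: f a (c - 1 - i - a))); last 2 first.
- by move=> t x y; rewrite scalerDl scalerA.
- exists (absz i + 1)%N => j j0.
  have [j1|j1] := ltP j 0; first by rewrite binomz_neg ?scale0r.
  by rewrite [binomz (_ - _) _]binomz_neg ?scaler0//; lia.
by apply: eq_zsum => j /=; rewrite scalerA.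
Qed.

End Lattice.

Section LinearMaps.
Variables (R : realType) (W W' : lmodType R[i]) (L : W -> W').
Hypothesis linL : linear L.

Lemma lin_0 : L 0 = 0.
Proof. by have := linL (-1) 0 0; rewrite !scaleN1r !addNr. Qed.

Lemma lin_Z c x : L (c *: x) = c *: L x.
Proof. by have := linL c x 0; rewrite lin_0 !addr0. Qed.

Lemma lin_D x y : L (x + y) = L x + L y.
Proof. by have := linL 1 x y; rewrite !scale1r. Qed.

Lemma lin_B x y : L (x - y) = L x - L y.
Proof. by rewrite lin_D -scaleN1r lin_Z scaleN1r. Qed.

Lemma diag_lin rho i (f : int -> int -> W) c : bt f ->
  diag rho i (fun a b => L (f a b)) c = L (diag rho i f c).
Proof.
move=> bf; rewrite /diag zsum_lin//; last exact: diag_fin.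
by apply: eq_zsum => a /=; rewrite lin_Z.
Qed.

Lemma iter_ldif_lin k (f : int -> int -> W) :
  iter k (@latdif _ _) (fun a b => L (f a b)) = fun a b => L (iter k (@latdif _ _) f a b).
Proof.
elim: k => [//|k IH]; apply/funext => a; apply/funext => b.
by rewrite !iterS IH /latdif lin_B.
Qed.

Lemma bt_lin (f : int -> int -> W) : bt f -> bt (fun a b => L (f a b)).
Proof. by move=> [N fN]; exists N => a b h; rewrite fN ?lin_0. Qed.

End LinearMaps.

(** * Series in three variables *)

Section ThreeVariables.
Variables (R : realType) (W : lmodType R[i]).
Local Notation C := R[i].
Local Notation ldif := (@latdif R W).
Implicit Types (G X : int -> int -> int -> W) (P Q : int -> int -> W).
Implicit Types (a b c p q n : int) (rho sigma : C).

Definition tri G := exists N : int, forall a b c,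
  [\/ N <= a, N <= b | N <= c] -> G a b c = 0.

Definition d12 G a b c : W := G (a + 1) b c - G a (b + 1) c.
Definition d13 G a b c : W := G (a + 1) b c - G a b (c + 1).
Definition d23 G a b c : W := G a (b + 1) c - G a b (c + 1).

(** The substitutions x1 = x + z, x2 = x + z and x1 = x2 + z, each with the remaining variable as a
    parameter. *)
Definition diag13 rho i G b c : W := diag rho i (fun a c => G a b c) c.
Definition diag23 sigma i G a c : W := diag sigma i (G a) c.
Definition diag12 rho i G b c : W := diag rho i (fun a b => G a b c) b.

Lemma subrACA (A : zmodType) (x y z t : A) : x - y - (z - t) = x - z - (y - t).
Proof. by rewrite !opprB addrACA [- y - z]addrC addrACA. Qed.

Lemma subrACA3 (A : zmodType) (x y z t u v : A) :
  x - y - (z - t) - (u - v) = x - z - u - (y - t - v).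
Proof. by rewrite (subrACA x) subrACA. Qed.

Lemma d12_d13C G : d12 (d13 G) = d13 (d12 G).
Proof.
apply/funext => a; apply/funext => b; apply/funext => c; rewrite /d12 /d13.
by rewrite subrACA.
Qed.

Lemma d12_d23C G : d12 (d23 G) = d23 (d12 G).
Proof.
apply/funext => a; apply/funext => b; apply/funext => c; rewrite /d12 /d23.
by rewrite subrACA.
Qed.

Lemma d13_d23C G : d13 (d23 G) = d23 (d13 G).
Proof.
apply/funext => a; apply/funext => b; apply/funext => c; rewrite /d13 /d23.
by rewrite subrACA.
Qed.

Lemma iterC (A : Type) (f g : A -> A) k l x : (forall y, f (g y) = g (f y)) ->
  iter k f (iter l g x) = iter l g (iter k f x).
Proof.
move=> fg; elim: l k => [//|l IH] k; rewrite [in LHS]iterS.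
transitivity (g (iter k f (iter l g x))); last by rewrite IH.
by elim: k => [//|k IHk] /=; rewrite -fg IHk.
Qed.

Lemma tri_bt13 G b : tri G -> bt (fun a c => G a b c).
Proof.
by move=> [N GN]; exists N => a c [h|h]; apply: GN; [constructor 1|constructor 3].
Qed.

Lemma tri_bt23 G a : tri G -> bt (G a).
Proof.
by move=> [N GN]; exists N => b c [h|h]; apply: GN; [constructor 2|constructor 3].
Qed.

Lemma tri_bt12 G c : tri G -> bt (fun a b => G a b c).
Proof.
by move=> [N GN]; exists N => a b [h|h]; apply: GN; [constructor 1|constructor 2].
Qed.

Lemma bt_diag23 sigma i G : tri G -> bt (diag23 sigma i G).
Proof.
move=> [N GN]; exists (Num.max N (N + N + 1 + i)) => a c [h|h].
  rewrite -[RHS](zsum0 W); apply: eq_zsum => b.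
  by rewrite GN ?scaler0//; constructor 1; lia.
apply: (@diag_trunc _ _ _ _ _ N); last by lia.
by move=> a' b' [h'|h']; apply: GN; [constructor 2|constructor 3].
Qed.

Lemma bt_diag13 rho i G : tri G -> bt (diag13 rho i G).
Proof.
move=> [N GN]; exists (Num.max N (N + N + 1 + i)) => b c [h|h].
  rewrite -[RHS](zsum0 W); apply: eq_zsum => a.
  by rewrite GN ?scaler0//; constructor 2; lia.
apply: (@diag_trunc _ _ _ _ _ N); last by lia.
by move=> a' b' [h'|h']; apply: GN; [constructor 1|constructor 3].
Qed.

Lemma bt_diag12 rho i G : tri G -> bt (diag12 rho i G).
Proof.
move=> [N GN]; exists (Num.max N (N + N + 1 + i)) => b c [h|h].
  apply: (@diag_trunc _ _ _ _ _ N); last by lia.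
  by move=> a' b' [h'|h']; apply: GN; [constructor 1|constructor 2].
rewrite -[RHS](zsum0 W); apply: eq_zsum => a.
by rewrite GN ?scaler0//; constructor 3; lia.
Qed.

(** Both sides are the coefficient of z1^s z2^t in H(z1,z2): the two substitutions commute because G
    is bounded in all variables. *)
Lemma diag13_diag23 rho sigma s t G c : tri G ->
  diag rho s (diag23 sigma t G) c = diag sigma t (diag13 rho s G) c.
Proof.
move=> triG; have [N GN] := triG.
transitivity (zsum (fun a => zsum (fun b =>
  (binomz (- a%:~R - 1 - rho) s * binomz (- b%:~R - 1 - sigma) t)
    *: G a b (c - 2 - s - t - a - b)))).
  apply: eq_zsum => a; rewrite -zsumZ; last exact/diag_fin/tri_bt23.
  by apply: eq_zsum => b; rewrite scalerA; congr (_ *: G _ _ _); lia.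
rewrite zsum_exch; last first.
  exists (3 * absz N + absz c + absz s + absz t + 5)%N => a b h.
  have [h1|h1] := leP N a; first by rewrite GN ?scaler0//; constructor 1.
  have [h2|h2] := leP N b; first by rewrite GN ?scaler0//; constructor 2.
  by rewrite GN ?scaler0//; constructor 3; lia.
apply: eq_zsum => b; rewrite -zsumZ; last exact: (diag_fin _ _ (tri_bt13 b triG)).
by apply: eq_zsum => a; rewrite scalerA mulrC; congr (_ *: G _ _ _); lia.
Qed.

(* The coefficient of [z0^s z2^t] in [H(z2 + z0, z2)], where [H(z1,z2) = G(x + z1, x + z2, x)]. *)
Lemma diag12_diag23 rho sigma s t G c : tri G -> 0 <= s ->
  diag (rho + sigma) t (diag12 rho s G) c
  = zsum (fun e => binomz (s + e)%:~R s *: diag rho (s + e) (diag23 sigma (t - e) G) c).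
Proof.
move=> triG s0; have [N GN] := triG.
transitivity (zsum (fun a => zsum (fun b => zsum (fun e =>
  (binomz (s + e)%:~R s * (binomz (- a%:~R - 1 - rho) (s + e)
     * binomz (- b%:~R - 1 - sigma) (t - e)))
    *: G a b (c - 2 - s - t - a - b))))); last first.
  have fin1 a b : zfin (fun e => (binomz (s + e)%:~R s * (binomz (- a%:~R - 1 - rho) (s + e)
     * binomz (- b%:~R - 1 - sigma) (t - e)))
    *: G a b (c - 2 - s - t - a - b)).
    exists (absz s + absz t + 1)%N => e he.
    have [h1|h1] := ltP e (- s); first by rewrite [binomz _ (s + e)]binomz_neg ?mul0r ?mulr0 ?scale0r//; lia.
    by rewrite [binomz _ (t - e)]binomz_neg ?mul0r ?mulr0 ?scale0r//; lia.
  (* The three indices of G have a fixed sum, so their common upper bound [N] leaves finitely many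
     triples. *)
  have GM a b : (a < - (3 * absz N + absz c + absz s + absz t + 5)%N%:Z \/
                  (3 * absz N + absz c + absz s + absz t + 5)%N%:Z <= a) \/
               (b < - (3 * absz N + absz c + absz s + absz t + 5)%N%:Z \/
                  (3 * absz N + absz c + absz s + absz t + 5)%N%:Z <= b) ->
      G a b (c - 2 - s - t - a - b) = 0.
    move=> h.
    have [h1|h1] := leP N a; first by rewrite GN//; constructor 1.
    have [h2|h2] := leP N b; first by rewrite GN//; constructor 2.
    by rewrite GN//; constructor 3; lia.
  transitivity (zsum (fun a => zsum (fun e => zsum (fun b =>
  (binomz (s + e)%:~R s * (binomz (- a%:~R - 1 - rho) (s + e)
     * binomz (- b%:~R - 1 - sigma) (t - e)))
    *: G a b (c - 2 - s - t - a - b))))).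
    apply: eq_zsum => a; apply: zsum_exch.
    exists (3 * absz N + absz c + absz s + absz t + 5 + absz a)%N => b e h.
    have [h1|h1] := ltP e (- s); first by rewrite [binomz _ (s + e)]binomz_neg ?mul0r ?mulr0 ?scale0r//; lia.
    have [h2|h2] := ltP t e; first by rewrite [binomz _ (t - e)]binomz_neg ?mul0r ?mulr0 ?scale0r//; lia.
    by rewrite GM ?scaler0//; lia.
  rewrite zsum_exch; last first.
    exists (3 * absz N + absz c + absz s + absz t + 5)%N => a e h.
    have [h1|h1] := ltP e (- s).
      rewrite -[RHS](zsum0 W); apply: eq_zsum => b.
      by rewrite [binomz _ (s + e)]binomz_neg ?mul0r ?mulr0 ?scale0r//; lia.
    have [h2|h2] := ltP t e.
      rewrite -[RHS](zsum0 W); apply: eq_zsum => b.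
      by rewrite [binomz _ (t - e)]binomz_neg ?mul0r ?mulr0 ?scale0r//; lia.
    rewrite -[RHS](zsum0 W); apply: eq_zsum => b.
    by rewrite GM ?scaler0//; lia.
  apply: eq_zsum => e; rewrite /diag -zsumZ; last exact/diag_fin/bt_diag23.
  apply: eq_zsum => a; rewrite scalerA /diag23 /diag -zsumZ; last exact/diag_fin/tri_bt23.
  by apply: eq_zsum => b; rewrite scalerA; congr (_ *: G _ _ _); [ring|lia].
transitivity (zsum (fun b => zsum (fun a =>
    (binomz (- b%:~R - 1 - (rho + sigma)) t * binomz (- a%:~R - 1 - rho) s)
     *: G a (b - 1 - s - a) (c - 1 - t - b)))).
  apply: eq_zsum => b; rewrite -zsumZ; last exact: (diag_fin _ _ (tri_bt12 (c - 1 - t - b) triG)).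
  by apply: eq_zsum => a; rewrite scalerA.
rewrite zsum_exch; last first.
  exists (4 * absz N + absz c + 2 * absz s + absz t + 8)%N => b a h.
  have [h1|h1] := leP N a; first by rewrite GN ?scaler0//; constructor 1.
  have [h2|h2] := leP N (b - 1 - s - a); first by rewrite GN ?scaler0//; constructor 2.
  by rewrite GN ?scaler0//; constructor 3; lia.
apply: eq_zsum => a; rewrite -[LHS](zsum_shift (1 + s + a)); apply: eq_zsum => b.
rewrite -[X in G _ X](_ : b = _); last by lia.
rewrite -[X in G _ _ X](_ : c - 2 - s - t - a - b = _); last by lia.
set w := G _ _ _; set x := - a%:~R - 1 - rho; set y := - b%:~R - 1 - sigma.
(* Here x and y are the exponents of x1 and x2. Taking z0^s from (x2 + z0)^x leaves x2 with exponent
   (x - s) + y; Vandermonde splits binom(x - s + y, t), and [binomz_trinomial] merges the two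
   binomials that come from x. *)
rewrite (_ : - (b + (1 + s + a))%:~R - 1 - (rho + sigma) = (x - s%:~R) + y); last by rewrite /x /y; ring.
rewrite -zsum_vandermonde mulrC.
have fin : zfin (fun j => binomz (x - s%:~R) j *: (binomz y (t - j) : C^o)).
  exists (absz t + 1)%N => j hj.
  have [j1|j1] := ltP j 0; first by rewrite binomz_neg ?scale0r.
  by rewrite [binomz _ (t - j)]binomz_neg ?scaler0//; lia.
rewrite (zsum_lin (L := fun z : C^o => (binomz x s * z) *: w))//; last first.
  by move=> u z z'; rewrite mulrDr scalerDl scalerA mulrCA.
apply: eq_zsum => e /=; congr (_ *: _).
by rewrite /GRing.scale /= mulrA binomz_trinomial// !mulrA.
Qed.

(** One has x1 - x2 = (x1 - x) - (x2 - x), and x2 - x becomes z under x2 = x + z. *)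
Lemma diag23_d12 sigma j X : (forall a, bt (X a)) ->
  diag23 sigma j (d12 X) = fun a c => ldif (diag23 sigma j X) a c - diag23 sigma (j - 1) X a c.
Proof.
move=> bX; apply/funext => a; apply/funext => c; rewrite /diag23.
have bX' : bt (fun b c => X a b (c + 1)).
  by have [N h] := bX a; exists N => b' c' hN; apply: h; lia.
have bL : bt (ldif (X a)) := bt_iter 1 (bX a).
rewrite {1}/latdif -diag_ldif// -[X in _ - X - _]diag_next.
rewrite -(diagB _ _ _ (bX (a + 1)) bX') -(diagB _ _ _ (btB (bX (a + 1)) bX') bL).
congr (diag _ _ _ _); apply/funext => b; apply/funext => c'.
by rewrite /d12 /latdif opprB addrA subrK.
Qed.

Lemma diag23_d13 sigma j X : (forall a, bt (X a)) ->
  diag23 sigma j (d13 X) = ldif (diag23 sigma j X).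
Proof.
move=> bX; apply/funext => a; apply/funext => c; rewrite /diag23.
have bX' : bt (fun b c => X a b (c + 1)).
  by have [N h] := bX a; exists N => b' c' hN; apply: h; lia.
by rewrite /latdif -[X in _ - X]diag_next -diagB.
Qed.

Lemma bt23_d12 X : (forall a, bt (X a)) -> forall a, bt (d12 X a).
Proof.
move=> bX a; rewrite /d12; apply: btB; first exact: bX.
by have [N h] := bX a; exists N => b' c' hN; apply: h; lia.
Qed.

Lemma bt23_d13 X : (forall a, bt (X a)) -> forall a, bt (d13 X a).
Proof.
move=> bX a; rewrite /d13; apply: btB; first exact: bX.
by have [N h] := bX a; exists N => b' c' hN; apply: h; lia.
Qed.

(** The series z^{-K} times the substituted (x1 - x)^K f no longer changes with K once (x1 - x)^K f
    is bounded, so exponents of different origin can be compared. *)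
Lemma iter_ldif_bt_le rho p (K L : nat) (f : int -> int -> W) c : (K <= L)%N ->
  bt (iter K ldif f) -> bt (iter L ldif f) /\
  diag rho (L%:Z - p) (iter L ldif f) c = diag rho (K%:Z - p) (iter K ldif f) c.
Proof.
move=> KL bK.
have -> : iter L ldif f = iter (L - K) ldif (iter K ldif f) by rewrite -iterD subnK.
split; first exact: bt_iter.
rewrite diag_iter// (_ : L%:Z - p - (L - K)%N%:Z = K%:Z - p)//; lia.
Qed.

(* [P p q] is the mode 0 of [u_p (v_q phi)] when [X] represents
   [(x2 - x)^l Y(u,x1) Y(v,x2) phi(x)]. *)
Definition left_modes rho sigma (l : int) X P := forall p q, exists K : nat,
  bt (iter K ldif (diag23 sigma (l - q - 1) X)) /\
  P p q = diag rho (K%:Z - p - 1) (iter K ldif (diag23 sigma (l - q - 1) X)) 0.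

(** After both substitutions x1 - x2 is z1 - z2, which acts on the modes as [ldif]. *)
Lemma left_modes_d12 rho sigma l X P : (forall a, bt (X a)) ->
  left_modes rho sigma l X P -> left_modes rho sigma l (d12 X) (ldif P).
Proof.
move=> bX XP p q.
have [K1 [b1 e1]] := XP (p + 1) q; have [K2 [b2 e2]] := XP p (q + 1).
pose K := maxn K1 K2; exists K.
have [b1' e1'] := iter_ldif_bt_le rho (p + 1 + 1) 0 (leqW (leq_maxl K1 K2)) b1.
have [b2' e2'] := iter_ldif_bt_le rho (p + 1) 0 (leq_maxr K1 K2) b2.
rewrite diag23_d12//.
have E : iter K ldif (fun a c => ldif (diag23 sigma (l - q - 1) X) a c -
    diag23 sigma (l - q - 1 - 1) X a c)
  = fun a c => iter K.+1 ldif (diag23 sigma (l - q - 1) X) a c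
    - iter K ldif (diag23 sigma (l - (q + 1) - 1) X) a c.
  apply/funext => a; apply/funext => c; rewrite iter_ldifB -iterSr.
  by rewrite (_ : l - (q + 1) - 1 = l - q - 1 - 1)//; lia.
rewrite E; split; first exact: btB.
rewrite diagB// {1}/latdif e1 e2; congr (_ - _).
  rewrite (_ : K%:Z - p - 1 = K.+1%:Z - (p + 1 + 1)); last by lia.
  by rewrite (_ : K1%:Z - (p + 1) - 1 = K1%:Z - (p + 1 + 1)) ?e1'//; lia.
rewrite (_ : K%:Z - p - 1 = K%:Z - (p + 1)); last by lia.
by rewrite (_ : K2%:Z - p - 1 = K2%:Z - (p + 1)) ?e2'//; lia.
Qed.

(** In [left_modes] the exponent K varies with p and q. Boundedness of the series in all three
    variables replaces it by one k, so that all modes are coefficients of the same power series. *)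
Lemma left_modesE rho sigma l X P (k m : nat) : (forall a, bt (X a)) ->
  left_modes rho sigma l X P -> tri (iter k d13 (iter m d12 X)) ->
  forall p q, iter m ldif P p q
    = diag rho (k%:Z - p - 1) (diag23 sigma (l - q - 1) (iter k d13 (iter m d12 X))) 0.
Proof.
move=> bX XP triG p q.
have bXm i : forall a, bt (iter i d12 X a) by elim: i => //= i IH; exact: bt23_d12.
have XPm : left_modes rho sigma l (iter m d12 X) (iter m ldif P).
  by elim: (m) => //= i IH; apply: left_modes_d12.
have dk j : diag23 sigma j (iter k d13 (iter m d12 X)) = iter k ldif (diag23 sigma j (iter m d12 X)).
  elim: (k) => //= i <-; rewrite diag23_d13//.
  by elim: i => [|i IH] //=; exact: bt23_d13.
have [K [bK ->]] := XPm p q.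
have bk := bt_diag23 sigma (l - q - 1) triG; rewrite dk in bk *.
rewrite (_ : K%:Z - p - 1 = K%:Z - (p + 1)); last by lia.
rewrite (_ : k%:Z - p - 1 = k%:Z - (p + 1)); last by lia.
have [_ <-] := iter_ldif_bt_le rho (p + 1) 0 (leq_maxl K k) bK.
by have [_ <-] := iter_ldif_bt_le rho (p + 1) 0 (leq_maxr K k) bk.
Qed.

(** One has x1 - x = (x1 - x2) + (x2 - x), and x1 - x2 becomes z under x1 = x2 + z. *)
Lemma diag12_d13 rho i X : (forall c, bt (fun a b => X a b c)) ->
  diag12 rho i (d13 X) = fun b c => diag12 rho (i - 1) X b c + ldif (diag12 rho i X) b c.
Proof.
move=> bX; apply/funext => b; apply/funext => c; rewrite /diag12.
have bX' : bt (fun a b => X a (b + 1) c).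
  by have [N h] := bX c; exists N => a' b' hN; apply: h; lia.
have bX2 : bt (fun a b => X a b (c + 1)) by exact: bX.
have bL : bt (ldif (fun a b => X a b c)) := bt_iter 1 (bX c).
rewrite {1}/latdif -diag_ldif// -[X in _ + (X - _)](diag_next rho i (fun a b => X a b c)).
rewrite -(diagB _ _ _ bX' bX2) -(diagD _ _ _ bL (btB bX' bX2)).
congr (diag _ _ _ _); apply/funext => a; apply/funext => b'.
by rewrite /d13 /latdif addrA subrK.
Qed.

Lemma diag12_d23 rho i X : (forall c, bt (fun a b => X a b c)) ->
  diag12 rho i (d23 X) = ldif (diag12 rho i X).
Proof.
move=> bX; apply/funext => b; apply/funext => c; rewrite /diag12.
have bX' : bt (fun a b => X a (b + 1) c).
  by have [N h] := bX c; exists N => a' b' hN; apply: h; lia.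
have bX2 : bt (fun a b => X a b (c + 1)) by exact: bX.
by rewrite /latdif -[X in _ = X - _](diag_next rho i (fun a b => X a b c)) -diagB.
Qed.

Lemma bt12_d13 X : (forall c, bt (fun a b => X a b c)) -> forall c, bt (fun a b => d13 X a b c).
Proof.
move=> bX c; rewrite /d13; apply: btB; last exact: (bX (c + 1)).
by have [N h] := bX c; exists N => a' b' hN; apply: h; lia.
Qed.

Lemma bt12_d23 X : (forall c, bt (fun a b => X a b c)) -> forall c, bt (fun a b => d23 X a b c).
Proof.
move=> bX c; rewrite /d23; apply: btB; last exact: (bX (c + 1)).
by have [N h] := bX c; exists N => a' b' hN; apply: h; lia.
Qed.

(** Multiplication by z0 + z2, which is what x1 - x becomes under x1 = x2 + z0 and x2 = x + z2. *)
Definition lsum Q n q : W := Q (n + 1) q + Q n (q + 1).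

(* [Q n q] is the mode 0 of [(u_n v)_q phi] when [X] represents
   [(x1 - x2)^m Y(u,x1) Y(v,x2) phi(x)]. *)
Definition iter_modes rho sigma (m : int) X Q := forall n q, exists K : nat,
  bt (iter K ldif (diag12 rho (m - n - 1) X)) /\
  Q n q = diag (rho + sigma) (K%:Z - q - 1) (iter K ldif (diag12 rho (m - n - 1) X)) 0.

Lemma iter_modes_d13 rho sigma m X Q : (forall c, bt (fun a b => X a b c)) ->
  iter_modes rho sigma m X Q -> iter_modes rho sigma m (d13 X) (lsum Q).
Proof.
move=> bX XQ n q.
have [K1 [b1 e1]] := XQ (n + 1) q; have [K2 [b2 e2]] := XQ n (q + 1).
pose K := maxn K1 K2; exists K.
have [b1' e1'] := iter_ldif_bt_le (rho + sigma) (q + 1) 0 (leq_maxl K1 K2) b1.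
have [b2' e2'] := iter_ldif_bt_le (rho + sigma) (q + 1 + 1) 0 (leqW (leq_maxr K1 K2)) b2.
rewrite diag12_d13//.
have E : iter K ldif (fun b c => diag12 rho (m - n - 1 - 1) X b c +
    ldif (diag12 rho (m - n - 1) X) b c)
  = fun b c => iter K ldif (diag12 rho (m - (n + 1) - 1) X) b c
    + iter K.+1 ldif (diag12 rho (m - n - 1) X) b c.
  apply/funext => b; apply/funext => c; rewrite iter_ldifD -iterSr.
  by rewrite (_ : m - (n + 1) - 1 = m - n - 1 - 1)//; lia.
rewrite E; split; first exact: btD.
rewrite diagD// {1}/lsum e1 e2; congr (_ + _).
  rewrite (_ : K%:Z - q - 1 = K%:Z - (q + 1)); last by lia.
  by rewrite (_ : K1%:Z - q - 1 = K1%:Z - (q + 1)) ?e1'//; lia.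
rewrite (_ : K%:Z - q - 1 = K.+1%:Z - (q + 1 + 1)); last by lia.
by rewrite (_ : K2%:Z - (q + 1) - 1 = K2%:Z - (q + 1 + 1)) ?e2'//; lia.
Qed.

Lemma iter_modesE rho sigma m X Q (k l : nat) : (forall c, bt (fun a b => X a b c)) ->
  iter_modes rho sigma m X Q -> tri (iter l d23 (iter k d13 X)) ->
  forall n q, iter k lsum Q n q
    = diag (rho + sigma) (l%:Z - q - 1) (diag12 rho (m - n - 1) (iter l d23 (iter k d13 X))) 0.
Proof.
move=> bX XQ triG n q.
have bXk i : forall c, bt (fun a b => iter i d13 X a b c).
  by elim: i => //= i IH; exact: bt12_d13.
have XQk : iter_modes rho sigma m (iter k d13 X) (iter k lsum Q).
  by elim: (k) => //= i IH; apply: iter_modes_d13.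
have dl j : diag12 rho j (iter l d23 (iter k d13 X)) = iter l ldif (diag12 rho j (iter k d13 X)).
  elim: (l) => //= i <-; rewrite diag12_d23//.
  by elim: i => [|i IH] //=; exact: bt12_d23.
have [K [bK ->]] := XQk n q.
have bl := bt_diag12 rho (m - n - 1) triG; rewrite dl in bl *.
rewrite (_ : K%:Z - q - 1 = K%:Z - (q + 1)); last by lia.
rewrite (_ : l%:Z - q - 1 = l%:Z - (q + 1)); last by lia.
have [_ <-] := iter_ldif_bt_le (rho + sigma) (q + 1) 0 (leq_maxl K l) bK.
by have [_ <-] := iter_ldif_bt_le (rho + sigma) (q + 1) 0 (leq_maxr K l) bl.
Qed.

(** * From locality and weak associativity to the Borcherds identity *)

Lemma iter_lsum k Q n q :
  iter k lsum Q n q = zsum (fun j => binomz (k%:Z)%:~R j *: Q (n + j) (q + k%:Z - j)).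
Proof.
have fin (i : nat) (f : int -> W) : zfin (fun j => binomz (i%:Z)%:~R j *: f j).
  exists i.+1 => j hj; have [j0|j0] := ltP j 0; first by rewrite binomz_neg ?scale0r.
  by rewrite binomz_nat ?scale0r//; lia.
elim: k n q => [|k IH] n q.
  rewrite (@zsum1 _ _ 0); first by rewrite binomz0 scale1r !addr0.
  move=> j j0; have [j1|j1] := ltP j 0; first by rewrite binomz_neg ?scale0r.
  by rewrite binomz_nat ?scale0r//; lia.
rewrite iterS /lsum !IH -[X in X + _](zsum_shift (-1)) -zsumD; last 2 first.
- have [N h] := fin k (fun j => Q (n + 1 + j) (q + k%:Z - j)).
  by exists N.+1 => j hj; apply: h; lia.
- exact: fin.
apply: eq_zsum => j.
rewrite (_ : (k.+1%:Z)%:~R = (k%:Z)%:~R + 1 :> C); last by rewrite -addn1 PoszD; ring.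
rewrite binomz_pascal addrC scalerDl; congr (_ *: Q _ _ + _ *: Q _ _); lia.
Qed.

(** Here [h s t] stands for the coefficient of z1^s z2^t in H, [P12] and [P21] for the two products
    and [Q] for the iterate. Multiplying the iterate by (z0 + z2)^k clears the pole z1^{-k}, which
    leaves the expansion of H(z2 + z0, z2) in the sixth hypothesis. *)
Lemma borcherds_of_modes (P12 P21 Q h : int -> int -> W) (k l m : nat) :
  (forall p q, l%:Z <= q -> P12 p q = 0) ->
  (forall p q, k%:Z <= p -> P21 p q = 0) ->
  (forall p q, iter m ldif P12 p q = h (k%:Z - p - 1) (l%:Z - q - 1)) ->
  (forall p q, iter m ldif P21 p q = h (k%:Z - p - 1) (l%:Z - q - 1)) ->
  (forall n q, m%:Z <= n -> Q n q = 0) ->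
  (forall n q, n < m%:Z -> iter k lsum Q n q
     = zsum (fun e => binomz (m%:Z - n - 1 + e)%:~R (m%:Z - n - 1)
                       *: h (m%:Z - n - 1 + e) (l%:Z - q - 1 - e))) ->
  (forall s t, s < 0 -> h s t = 0) ->
  forall n p q, mulz n P12 p q - mulz' n P21 p q
    = zsum (fun j => binomz p%:~R j *: Q (n + j) (p + q - j)).
Proof.
move=> H12 H21 E12 E21 HQ EQ h0.
have t12 : trr P12 by exists l%:Z => p q; exact: H12.
have t21 : trl P21 by exists k%:Z => p q; exact: H21.
have finQ n p q (f : int -> int) : zfin (fun j => binomz p%:~R j *: Q (n + j) (f j)).
  by apply: zfin_binom; exists (m%:Z - n) => j hj; apply: HQ; lia.
pose S n p q := zsum (fun j => binomz p%:~R j *: Q (n + j) (p + q - j)).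
pose J n p q := mulz n P12 p q - mulz' n P21 p q - S n p q.
suff J0 n p q : J n p q = 0.
  by move=> n p q; apply/eqP; rewrite -subr_eq0; apply/eqP; exact: J0.
have SS n' p' q' : S (n' + 1) p' q' = S n' (p' + 1) q' - S n' p' (q' + 1).
  rewrite /S -zsumB; [|exact: finQ|exact: finQ].
  rewrite -[LHS](zsum_shift (-1)); apply: eq_zsum => j.
  rewrite (_ : (p' + 1)%:~R = p'%:~R + 1 :> C); last by ring.
  rewrite binomz_pascal scalerDl.
  rewrite (_ : p' + (q' + 1) - j = p' + 1 + q' - j); last by lia.
  rewrite [RHS]addrAC subrr add0r; congr (_ *: Q _ _); lia.
have JS n' p' q' : J (n' + 1) p' q' = J n' (p' + 1) q' - J n' p' (q' + 1).
  rewrite /J SS /mulz /mulz' !zconvS//; [|exact: mulz_rS|by move=> *; apply: mulz_r_fin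
     |exact: mulz_lS|by move=> *; apply: mulz_l_fin].
  by rewrite subrACA3.
have Jge n' p' q' : m%:Z <= n' -> J n' p' q' = 0.
  move=> mn; rewrite /J /S (_ : zsum _ = 0) ?subr0.
    rewrite -[n'](subrK m%:Z) -mulz_iter// -mulz'_iter// mulz_mulz'; last by lia.
    apply/eqP; rewrite subr_eq0; apply/eqP; congr (mulz' _ _ _ _).
    by apply/funext => a; apply/funext => b; rewrite E12 E21.
  rewrite -[RHS](zsum0 W); apply: eq_zsum => j.
  have [j0|j0] := ltP j 0; first by rewrite binomz_neg ?scale0r.
  by rewrite HQ ?scaler0//; lia.
(* At p = k the second product contains only modes u_p with p >= k, which kill phi, and the
   right-hand sum is (z0 + z2)^k applied to [Q]. The first product is matched with it by
   [binomz_opp], or by [h0] where the order in z1 is negative. *)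
have Jk n' q' : n' < m%:Z -> J n' k%:Z q' = 0.
  move=> nm; rewrite /J (_ : mulz' _ _ _ _ = 0); last first.
    rewrite -[RHS](zsum0 W); apply: eq_zsum => j; rewrite /mulz_r.
    have [j0|j0] := ltP n' j; first by rewrite binomz_neg ?mulr0 ?scale0r//; lia.
    by rewrite H21 ?scaler0//; lia.
  rewrite subr0 (_ : S n' k%:Z q' = iter k lsum Q n' q'); last first.
    by rewrite iter_lsum; apply: eq_zsum => j; congr (_ *: Q _ _); lia.
  rewrite EQ// -[in X in X - _](subrK m%:Z n') -mulz_iter//.
  apply/eqP; rewrite subr_eq0; apply/eqP; apply: eq_zsum => e.
  rewrite E12 /mulz_l.
  have -> : k%:Z - (k%:Z + (n' - m%:Z) - e) - 1 = m%:Z - n' - 1 + e by lia.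
  have -> : l%:Z - (q' + e) - 1 = l%:Z - q' - 1 - e by lia.
  have [s0|s0] := ltP (m%:Z - n' - 1 + e) 0; first by rewrite h0 ?scaler0.
  rewrite -binomz_opp//; last by lia.
  by congr (_ * binomz _ _ *: _); ring.
have Jdown (i : nat) n' p' q' : m%:Z <= n' + i%:Z -> J n' p' q' = 0.
  elim: i n' p' q' => [|i IH] n' p' q' hi; first by apply: Jge; lia.
  have [mn|nm] := leP m%:Z n'; first exact: Jge.
  (* Since J vanishes at n' + 1, its value at n' depends only on p + q. Every line p + q = const
     meets p = k, where [Jk] applies. *)
  have step p2 q2 : J n' (p2 + 1) q2 = J n' p2 (q2 + 1).
    by apply/eqP; rewrite -subr_eq0 -JS; apply/eqP; apply: IH; lia.
  have stepn (j : nat) p2 q2 : J n' (p2 + j%:Z) q2 = J n' p2 (q2 + j%:Z).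
    elim: j p2 q2 => [|j IHj] p2 q2; first by rewrite !addr0.
    rewrite (_ : p2 + j.+1%:Z = p2 + 1 + j%:Z); last by lia.
    by rewrite IHj step; congr (J _ _ _); lia.
  have [pk|kp] := leP p' k%:Z.
    have := stepn (absz (k%:Z - p')) p' (q' - (k%:Z - p')).
    rewrite (_ : p' + _ = k%:Z); last by lia.
    rewrite (_ : q' - _ + _ = q'); last by lia.
    by move=> <-; apply: Jk.
  have := stepn (absz (p' - k%:Z)) k%:Z q'.
  rewrite (_ : k%:Z + _ = p'); last by lia.
  by move=> ->; apply: Jk.
by apply: (Jdown (absz (m%:Z - n))); lia.
Qed.

End ThreeVariables.

(** * Twisted modules *)

Section Conversion.
Variables (R : realType) (E1 E2 : zmodType) (e1 : E1) (e2 : E2) (W : lmodType R[i]).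

(** The operation moves indices only along e1 and e2, so each coset of the exponent groups is
    treated as a copy of the integer lattice. *)
Lemma mul_x1Bx2E n (F : E1 -> E2 -> W) a0 b0 a b :
  mul_x1Bx2 e1 e2 n F (a0 + e1 *~ a) (b0 + e2 *~ b)
  = mulz n (fun i j => F (a0 + e1 *~ i) (b0 + e2 *~ j)) a b.
Proof.
rewrite /mulz /zconv zsum_nat => [|j]; last first.
  by rewrite /mulz_l binomz_neg ?mulr0 ?scale0r.
apply: eq_fsbigr => j _; rewrite /mulz_l; congr (_ *: F _ _).
  by rewrite -addrA -mulrzDr addrA.
by rewrite -addrA -mulrzDr.
Qed.

Lemma mul_Nx2Dx1E n (F : E1 -> E2 -> W) a0 b0 a b :
  mul_Nx2Dx1 e1 e2 n F (a0 + e1 *~ a) (b0 + e2 *~ b)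
  = mulz' n (fun i j => F (a0 + e1 *~ i) (b0 + e2 *~ j)) a b.
Proof.
rewrite /mulz' /zconv -(zsum_refl n) zsum_nat => [|j]; last first.
  by rewrite /mulz_r subKr binomz_neg ?mulr0 ?scale0r.
apply: eq_fsbigr => j _; rewrite /mulz_r subKr; congr (_ *: F _ _).
  by rewrite -addrA -mulrzDr (_ : a + n - (n - j%:Z) = a + j%:Z)//; lia.
by rewrite -addrA -mulrzDr.
Qed.

End Conversion.

Lemma binomz_zero (R : realType) j : j != 0 -> binomz (0 : R[i]) j = 0.
Proof.
move=> j0; have [j1|j1] := ltP j 0; first exact: binomz_neg.
by rewrite -(mulr0z (1 : R[i])) binomz_nat//; lia.
Qed.

Lemma zsum2 (R : realType) (W : lmodType R[i]) (f : int -> W) :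
  (forall j, j != 0 -> j != 1 -> f j = 0) -> zsum f = f 0 + f 1.
Proof.
move=> f0; rewrite (@zsumE _ _ 2); last by move=> j hj; apply: f0; lia.
rewrite !big_ord_recr big_ord0 /= add0r (f0 (0%:Z - 2%:Z))// (f0 (1%:Z - 2%:Z))//.
by rewrite !add0r.
Qed.

Lemma binomz_upper_neg (R : realType) (x : R[i]) (j : nat) :
  (-1) ^+ j * binom (j%:R - 1 - x) j = binom x j.
Proof.
rewrite /binom mulrA; congr (_ / _).
rewrite (reindex_inj rev_ord_inj) /= -[j in (-1) ^+ j]card_ord -prodrN.
apply: eq_bigr => i _; rewrite natrB; last exact: ltn_ord.
by rewrite -addn1 natrD; ring.
Qed.

(* The constraint on [(k, j)] forces [k = j - (a + q) - 1], and upper negation then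
   removes the sign; [r0 + T q] is the representative [r] of the residue class. *)
Lemma jacobi_rhsE (R : realType) (W : lmodType R[i]) (T r0 : nat) (q a b s : int)
    (F : nat -> int -> W) : (0 < T)%N ->
  \sum_(kj \in [set kj : int * nat | kj.1 * T%:Z - r0%:Z - kj.2%:Z * T%:Z
                  = - (r0%:Z + T%:Z * q + T%:Z *~ a) - T%:Z])
     ((-1) ^+ kj.2 * binom (kj.1%:~R - r0%:R / T%:R) kj.2) *:
       F kj.2 ((s + T%:Z *~ b) - kj.1 * T%:Z - T%:Z + r0%:Z)
  = \sum_(j \in [set: nat]) binomz (a%:~R + (r0%:R / T%:R + q%:~R)) j%:Z *:
       F j (r0%:Z + T%:Z * q + s + T%:Z *~ (a + b - j%:Z)).
Proof.
move=> T0; rewrite (@reindex_fsbig _ _ _ nat _ (fun j : nat => (j%:Z - (a + q) - 1, j)) setT).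
  apply: eq_fsbigr => j _ /=; congr (_ *: F _ _); last by rewrite !mulrzz; ring.
  rewrite -[RHS]binomz_upper_neg; congr (_ * binom _ _).
  by rewrite !rmorphB /= rmorphD /=; ring.
split.
- by move=> j _ /=; rewrite mulrzz; ring.
- by move=> i j _ _ [].
move=> [k j] /= kj; exists j => //; congr pair.
have T0' : T%:Z != 0 by lia.
apply: (mulIf T0').
have -> : k * T%:Z = (k * T%:Z - r0%:Z - j%:Z * T%:Z) + r0%:Z + j%:Z * T%:Z by ring.
by rewrite kj mulrzz; ring.
Qed.

(** Vandermonde's identity for -rho + rho = 0. It isolates one mode of u_n v from the right-hand sum
    of the Borcherds identity. *)
Lemma binomz_invert (R : realType) (W : lmodType R[i]) (rho : R[i]) (m : int)
    (F : int -> int -> W) n c : (forall n c, m <= n -> F n c = 0) ->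
  zsum (fun j => binomz (- rho) j *: zsum (fun i => binomz rho i *: F (n + j + i) (c - j - i)))
  = F n c.
Proof.
move=> F0.
transitivity (zsum (fun j => zsum (fun t =>
   (binomz (- rho) j * binomz rho (t - j)) *: F (n + t) (c - t)))).
  apply: eq_zsum => j; rewrite -zsumZ; last first.
    by apply: zfin_binom; exists (m - n - j) => i hi; apply: F0; lia.
  rewrite -[RHS](zsum_shift j); apply: eq_zsum => t.
  rewrite scalerA addrK (_ : n + j + t = n + (t + j)); last by lia.
  by rewrite (_ : c - j - t = c - (t + j))//; lia.
rewrite zsum_exch; last first.
  exists (absz m + absz n + 1)%N => j t h.
  have [j0|j0] := ltP j 0; first by rewrite binomz_neg ?mul0r ?scale0r.
  have [tj|tj] := ltP t j; first by rewrite [binomz _ (t - j)]binomz_neg ?mulr0 ?scale0r//; lia.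
  by rewrite F0 ?scaler0//; lia.
have fin t : zfin (fun j => binomz (- rho) j *: (binomz rho (t - j) : R[i]^o)).
  apply: zfin_binom; exists (t + 1) => j hj; rewrite binomz_neg//; lia.
transitivity (zsum (fun t => (binomz (- rho + rho) t : R[i]) *: F (n + t) (c - t))).
  apply: eq_zsum => t; rewrite -zsum_vandermonde.
  rewrite (zsum_lin (L := fun z : R[i]^o => z *: F (n + t) (c - t)))//.
  by move=> u z z'; rewrite scalerDl scalerA.
rewrite addNr (@zsum1 _ _ 0); first by rewrite binomz0 scale1r addr0 subr0.
by move=> j j0; rewrite binomz_zero ?scale0r.
Qed.

Section Modules.
Variables (R : realType) (V : voa R) (tau : V -> V) (T : nat).
Hypotheses (aut_tau : voa_automorphism tau) (ord_tau : has_order tau T).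
Local Notation C := R[i].
Local Notation ldif := (@latdif R _).

Lemma aut_order_gt0 : (0 < T)%N. Proof. by case: ord_tau. Qed.
Hint Resolve aut_order_gt0 : core.

Lemma aut_order_neq0 : T%:R != 0 :> C.
Proof. by rewrite pnatr_eq0 -lt0n. Qed.
Hint Resolve aut_order_neq0 : core.

Lemma eig_ind (P : V -> Prop) : P 0 -> (forall u v, P u -> P v -> P (u + v)) ->
  (forall r u, (r < T)%N -> eigsp tau T r u -> P u) -> forall u, P u.
Proof.
move=> P0 PD Peig u; rewrite -(eigproj_sum ord_tau u).
by elim/big_ind: _ => // r _; apply: Peig (ltn_ord r) (eigproj_in aut_tau ord_tau r u).
Qed.

(** For u in V^r and v in V^s the index r + s of u_n v may reach T or more, so the statements below
    allow any natural r and are reduced to r %% T. *)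
Lemma eigsp_mod r u : eigsp tau T r u -> eigsp tau T (r %% T) u.
Proof.
rewrite /eigsp /= => ->; congr (_ *: _).
by rewrite zetaX {1}(divn_eq r T) exprD mulnC exprM zeta_expT// expr1n mul1r -zetaX.
Qed.

Lemma eigsp_Y r s u v n : eigsp tau T r u -> eigsp tau T s v ->
  eigsp tau T (r + s) (voa_Y u n v).
Proof.
rewrite /eigsp /= => ur vs; have [_ _ _ _ ->] := aut_tau; rewrite ur vs.
rewrite (lin_Z (voa_Y_linearr _ _)) (lin_Z (voa_Y_linearl n v)) scalerA.
by congr (_ *: _); rewrite [RHS]zetaX exprD -!zetaX mulrC.
Qed.

Lemma nat_divE (r : nat) : r%:Z = (r %% T)%N%:Z + T%:Z * (r %/ T)%N%:Z.
Proof. by rewrite {1}(divn_eq r T) PoszD PoszM addrC mulrC. Qed.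

Lemma nat_divE_ratio (r : nat) : r%:R / T%:R = (r %% T)%:R / T%:R + ((r %/ T)%N%:Z)%:~R :> C.
Proof.
apply: (mulIf aut_order_neq0); rewrite mulrDl !divfK//.
by rewrite {1}(divn_eq r T) natrD natrM addrC.
Qed.

Variable M : weak_twisted_module tau T.
Implicit Types (u v : V) (w : M).

Lemma wtm_linl k w : linear (fun u => wtm_Y u k w).
Proof. exact: (wtm_linearl (wtm_axioms M)). Qed.

Lemma wtm_linr u k : linear (@wtm_Y _ _ _ _ M u k).
Proof. exact: (wtm_linearr (wtm_axioms M)). Qed.

Lemma wtm_truncated u w : exists N : int, forall k, N <= k -> wtm_Y u k w = 0.
Proof.
elim/eig_ind: u => [|u v [N uN] [K vK]|r u rT ur].
- by exists 0 => k _; rewrite (lin_0 (wtm_linl k w)).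
- exists (Num.max N K) => k h.
  by rewrite (lin_D (wtm_linl k w)) uN ?vK ?addr0//; lia.
exact: (wtm_trunc (wtm_axioms M)) rT ur.
Qed.

Lemma wtm_trunc_lattice u w (s : int) :
  exists N : int, forall b, N <= b -> wtm_Y u (s + T%:Z *~ b) w = 0.
Proof.
have [N uN] := wtm_truncated u w; exists (Num.max 0 (N - s)) => b hb.
apply: uN; rewrite mulrzz.
have : 1 * b <= T%:Z * b by rewrite ler_wpM2r//; lia.
by lia.
Qed.

(** Only u is an eigenvector; v is arbitrary and its modes are counted from any offset s. This
    generality is what (G3) for u_n^H phi calls for. *)
Lemma wtm_borcherds (r : nat) (s : int) u v w n a b : eigsp tau T r u ->
  mulz n (fun a b => wtm_Y u (r%:Z + T%:Z *~ a) (wtm_Y v (s + T%:Z *~ b) w)) a b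
  - mulz' n (fun a b => wtm_Y v (s + T%:Z *~ b) (wtm_Y u (r%:Z + T%:Z *~ a) w)) a b
  = zsum (fun j => binomz (a%:~R + r%:R / T%:R) j *:
      wtm_Y (voa_Y u (n + j) v) (r%:Z + s + T%:Z *~ (a + b - j)) w).
Proof.
move=> ur; have r0 : (r %% T < T)%N by rewrite ltn_pmod.
have := wtm_jacobi (wtm_axioms M) v w r0 (eigsp_mod ur) n (r%:Z + T%:Z *~ a) (s + T%:Z *~ b).
rewrite mul_x1Bx2E mul_Nx2Dx1E => ->.
rewrite [in LHS](nat_divE r).
rewrite (jacobi_rhsE _ _ _ _ _ (fun j l => wtm_Y (voa_Y u (n + j%:Z) v) l w))//.
rewrite zsum_nat; last by move=> j; rewrite binomz_neg ?scale0r.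
by apply: eq_fsbigr => j _; rewrite -nat_divE -nat_divE_ratio.
Qed.

Lemma wtm_trr u v w (r s : int) :
  trr (fun a b => wtm_Y u (r + T%:Z *~ a) (wtm_Y v (s + T%:Z *~ b) w)).
Proof.
have [N h] := wtm_trunc_lattice v w s; exists N => a b hb.
by rewrite h// (lin_0 (wtm_linr _ _)).
Qed.

Lemma wtm_trl u v w (r s : int) :
  trl (fun a b => wtm_Y v (s + T%:Z *~ b) (wtm_Y u (r + T%:Z *~ a) w)).
Proof.
have [N h] := wtm_trunc_lattice u w r; exists N => a b hb.
by rewrite h// (lin_0 (wtm_linr _ _)).
Qed.

(** Locality and weak associativity in the twisted module. The first holds because u_n v = 0 for n
    >= m. For the second, the Borcherds identity at a = 0, inverted by [binomz_invert], is the
    residue treated in [residue_diag]: u_n v arises from Y(u,x1) Y(v,x2) as u_n^H phi does from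
    Y(u,x1) phi(x). The exponent m depends on neither s nor w. *)
Lemma wtm_ope (r : nat) u v : eigsp tau T r u -> exists m : nat,
  (forall n, m%:Z <= n -> voa_Y u n v = 0) /\
  forall (s : int) w,
    let A := fun a b => wtm_Y u (r%:Z + T%:Z *~ a) (wtm_Y v (s + T%:Z *~ b) w) in
    let B := fun a b => wtm_Y v (s + T%:Z *~ b) (wtm_Y u (r%:Z + T%:Z *~ a) w) in
    iter m ldif A = iter m ldif B /\
    forall n c, wtm_Y (voa_Y u n v) (r%:Z + s + T%:Z *~ c) w
      = diag (r%:R / T%:R) (m%:Z - n - 1) (iter m ldif A) c.
Proof.
move=> ur; have [N uvN] := voa_trunc u v.
have uv0 n : (absz N)%:Z <= n -> voa_Y u n v = 0 by move=> h; apply: uvN; lia.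
exists (absz N); split => // s w A B.
have tA : trr A by exact: wtm_trr.
have tB : trl B by exact: wtm_trl.
have YF0 k : wtm_Y 0 k w = 0 := lin_0 (wtm_linl k w).
have AB : iter (absz N) ldif A = iter (absz N) ldif B.
  rewrite -mulz_nat// -mulz'_nat//; apply/funext => a; apply/funext => b.
  apply/eqP; rewrite -subr_eq0; apply/eqP; rewrite wtm_borcherds//.
  rewrite -[RHS](zsum0 M); apply: eq_zsum => j.
  have [j0|j0] := ltP j 0; first by rewrite binomz_neg ?scale0r.
  by rewrite uv0 ?YF0 ?scaler0//; lia.
split=> // n c; rewrite -(residue_diag (r%:R / T%:R) n c tA tB AB).
rewrite -[LHS](binomz_invert (r%:R / T%:R) (m := (absz N)%:Z)
   (F := fun n c => wtm_Y (voa_Y u n v) (r%:Z + s + T%:Z *~ c) w)); last first.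
  by move=> n' c' h; rewrite uv0 ?YF0.
apply: eq_zsum => j; rewrite wtm_borcherds//; congr (_ *: _); apply: eq_zsum => i.
by rewrite !add0r.
Qed.

Lemma vac_eigsp : eigsp tau T 0 (voa_vac V).
Proof. by rewrite /eigsp /= zetaE expr0 scale1r; case: aut_tau. Qed.

Lemma omega_eigsp : eigsp tau T 0 (voa_omega V).
Proof. by rewrite /eigsp /= zetaE expr0 scale1r; case: aut_tau. Qed.

Lemma wtm_translation_comm v (s : int) w :
  wtm_Y (voa_omega V) 0 (wtm_Y v s w) - wtm_Y v s (wtm_Y (voa_omega V) 0 w)
  = wtm_Y (voa_Y (voa_omega V) 0 v) s w.
Proof.
have := wtm_borcherds s v w 0 0 0 omega_eigsp.
rewrite -mulz_mulz'// !mulz0 !mulr0z !addr0 => ->.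
rewrite (@zsum1 _ _ 0); first by rewrite binomz0 scale1r subr0 mulr0z !addr0 add0r.
by move=> j j0; rewrite mul0r addr0 binomz_zero ?scale0r.
Qed.

Lemma voa_translation u : voa_Y (voa_omega V) 0 u = voa_Y u (-2) (voa_vac V).
Proof.
have := voa_derivation u (-1) (voa_vac V).
by rewrite (voa_creation _).1 opprK scale1r.
Qed.

(** The derivative property is not among the axioms of a weak twisted module. It is the Borcherds
    identity for u and the vacuum with n = -2 and b = 0: both products miss the only nonzero mode of
    the vacuum, and on the right only j = 0 and j = 1 survive, with u_{-2} 1 = L(-1) u and u_{-1} 1
    = u. *)
Lemma wtm_derivation (r : nat) u (a : int) w : eigsp tau T r u ->
  wtm_Y (voa_Y (voa_omega V) 0 u) (r%:Z + T%:Z *~ a) w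
  = - (a%:~R + r%:R / T%:R) *: wtm_Y u (r%:Z + T%:Z *~ (a - 1)) w.
Proof.
move=> ur.
have := wtm_borcherds 0 (voa_vac V) w (-2) a 0 ur.
have vac0 (b : int) w' : b != -1 -> wtm_Y (voa_vac V) (0 + T%:Z *~ b) w' = 0.
  move=> b1; rewrite (wtm_vacuum (wtm_axioms M)) ifN// add0r mulrzz.
  by have := aut_order_gt0; nia.
rewrite [X in X - _](_ : _ = 0); last first.
  rewrite -[RHS](zsum0 M); apply: eq_zsum => j.
  have [j0|j0] := ltP j 0; first by rewrite /mulz_l binomz_neg ?mulr0 ?scale0r.
  by rewrite vac0 ?(lin_0 (wtm_linr _ _)) ?scaler0//; lia.
rewrite [X in _ - X](_ : _ = 0); last first.
  rewrite -[RHS](zsum0 M); apply: eq_zsum => j.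
  have [j0|j0] := ltP (-2) j; first by rewrite /mulz_r binomz_neg ?mulr0 ?scale0r//; lia.
  by rewrite vac0 ?scaler0//; lia.
rewrite subr0 => /esym.
set G := fun j : int => _.
have G0 j : j != 0 -> j != 1 -> G j = 0.
  move=> j0 j1; rewrite /G; have [j2|j2] := ltP j 0; first by rewrite binomz_neg ?scale0r.
  rewrite (voa_creation u).2 ?(lin_0 (wtm_linl _ _)) ?scaler0//; lia.
rewrite zsum2// /G binomz0 scale1r !addr0 -voa_translation => /eqP.
rewrite addr_eq0 => /eqP ->; rewrite scaleNr (voa_creation u).1.
congr (- (_ *: _)).
by rewrite /= /binom big_ord1 subr0 divr1.
Qed.

Lemma wtm_translation (r : nat) u (a : int) w : eigsp tau T r u ->
  wtm_Y (voa_omega V) 0 (wtm_Y u (r%:Z + T%:Z *~ a) w)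
  - wtm_Y u (r%:Z + T%:Z *~ a) (wtm_Y (voa_omega V) 0 w)
  = - (a%:~R + r%:R / T%:R) *: wtm_Y u (r%:Z + T%:Z *~ (a - 1)) w.
Proof. by move=> ur; rewrite wtm_translation_comm wtm_derivation. Qed.

End Modules.

(** * Truncation and Dong's lemma for series in three variables *)

Section LocalityInThreeVariables.
Variables (R : realType) (W : lmodType R[i]).
Local Notation ldif := (@latdif R W).
Implicit Types (G X Z : int -> int -> int -> W).

Lemma iter_d12E k X a b c : iter k (@d12 R W) X a b c = iter k ldif (fun a b => X a b c) a b.
Proof. by elim: k a b => [//|k IH] a b; rewrite !iterS /d12 /latdif !IH. Qed.

Lemma iter_d13E k X a b c : iter k (@d13 R W) X a b c = iter k ldif (fun a c => X a b c) a c.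
Proof. by elim: k a c => [//|k IH] a c; rewrite !iterS /d13 /latdif !IH. Qed.

Lemma iter_d23E k X a b c : iter k (@d23 R W) X a b c = iter k ldif (X a) b c.
Proof. by elim: k b c => [//|k IH] b c; rewrite !iterS /d23 /latdif !IH. Qed.

Lemma iter_d12_swap m X : iter m (@d12 R W) (fun a b c => X b a c)
  = fun a b c => (-1) ^+ m *: iter m (@d12 R W) X b a c.
Proof.
elim: m => [|m IH]; apply/funext => a; apply/funext => b; apply/funext => c.
  by rewrite expr0 scale1r.
by rewrite !iterS IH /d12 -scalerBr exprS mulN1r scaleNr -scalerN opprB.
Qed.

Lemma iter_ldif_swap m (f : int -> int -> W) q p :
  iter m ldif (fun q p => f p q) q p = (-1) ^+ m *: iter m ldif f p q.
Proof.
elim: m q p => [|m IH] q p; first by rewrite expr0 scale1r.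
by rewrite !iterS /latdif !IH -scalerBr exprS mulN1r scaleNr -scalerN opprB.
Qed.

Section Vanishing.
Variable S : int -> int -> int -> Prop.
Hypotheses (S1 : forall a b c, S a b c -> S (a + 1) b c)
  (S2 : forall a b c, S a b c -> S a (b + 1) c)
  (S3 : forall a b c, S a b c -> S a b (c + 1)).
(** The region [S] is closed under raising indices, so truncation in one variable survives
    multiplication by the difference of any two. *)
Definition vanish X := forall a b c, S a b c -> X a b c = 0.

Lemma vanish_d12 k X : vanish X -> vanish (iter k (@d12 R W) X).
Proof.
move=> X0; elim: k => //= k IH a b c h; rewrite /d12 !IH ?subrr//.
  exact: S2.
exact: S1.
Qed.

Lemma vanish_d13 k X : vanish X -> vanish (iter k (@d13 R W) X).
Proof.
move=> X0; elim: k => //= k IH a b c h; rewrite /d13 !IH ?subrr//.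
  exact: S3.
exact: S1.
Qed.

Lemma vanish_d23 k X : vanish X -> vanish (iter k (@d23 R W) X).
Proof.
move=> X0; elim: k => //= k IH a b c h; rewrite /d23 !IH ?subrr//.
  exact: S3.
exact: S2.
Qed.

End Vanishing.

Lemma diag13_d23 rho i X : (forall b, bt (fun a c => X a b c)) ->
  diag13 rho i (d23 X) = ldif (diag13 rho i X).
Proof.
move=> bX; apply/funext => b; apply/funext => c; rewrite /diag13.
have bX' : bt (fun a c => X a b (c + 1)).
  by have [N h] := bX b; exists N => a' c' hN; apply: h; lia.
have bX2 : bt (fun a c => X a (b + 1) c) by exact: bX.
by rewrite /latdif -[X in _ = _ - X](diag_next rho i (fun a c => X a b c)) -diagB.
Qed.

Lemma bt13_d23 X : (forall b, bt (fun a c => X a b c)) -> forall b, bt (fun a c => d23 X a b c).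
Proof.
move=> bX b; rewrite /d23; apply: btB; first exact: (bX (b + 1)).
by have [N h] := bX b; exists N => a' c' hN; apply: h; lia.
Qed.

Lemma bt13_d12 X : (forall b, bt (fun a c => X a b c)) -> forall b, bt (fun a c => d12 X a b c).
Proof.
move=> bX b; rewrite /d12; apply: btB; last exact: (bX (b + 1)).
by have [N h] := bX b; exists N => a' c' hN; apply: h; lia.
Qed.

Lemma ldif_diag13 rho i X : (forall b, bt (fun a c => X a b c)) ->
  ldif (diag13 rho i X) = fun b c => diag13 rho (i - 1) X b c - diag13 rho i (d12 X) b c.
Proof.
move=> bX; rewrite -diag13_d23//; apply/funext => b; apply/funext => c; rewrite /diag13.
rewrite -(diag_ldif rho i c (bX b)).
rewrite -(diagB _ _ _ (bt_iter 1 (bX b)) (bt13_d12 bX b)).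
congr (diag _ _ _ _); apply/funext => a; apply/funext => c'.
by rewrite /d12 /d23 /= /latdif opprB [RHS]addrC addrA subrK.
Qed.

(* Dong's lemma: [x2 - x = (x1 - x) - (x1 - x2)], and each factor [x1 - x]
   lowers by one the order of the coefficient that [diag13] extracts. *)
Lemma diag13_local rho (m j : nat) i X Z : i < j%:Z ->
  (forall b, bt (fun a c => X a b c)) -> (forall b, bt (fun a c => Z a b c)) ->
  iter m (@d12 R W) X = iter m (@d12 R W) Z ->
  iter (m + j) ldif (diag13 rho i X) = iter (m + j) ldif (diag13 rho i Z).
Proof.
elim: m j i X Z => [|m IHm] j i X Z ij bX bZ; first by rewrite /= => ->.
elim: j i ij => [|j IHj] i ij XZ.
  (* For j = 0 the order i is negative, and both extracted coefficients are 0. *)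
  congr (iter _ _ _); apply/funext => b; apply/funext => c.
  by rewrite /diag13 !diag_neg.
rewrite addSn !iterSr !ldif_diag13//.
apply/funext => b; apply/funext => c; rewrite !iter_ldifB; congr (_ - _).
  by rewrite -addSnnS IHj//; lia.
rewrite (IHm j.+1 _ _ _ ij (bt13_d12 bX) (bt13_d12 bZ))//.
by rewrite -!iterSr.
Qed.

End LocalityInThreeVariables.

(** * The modes of the action on intertwining operators *)

Section Intertwiners.
Variables (R : realType) (V : voa R) (tau : V -> V) (T : nat).
Hypotheses (aut_tau : voa_automorphism tau) (ord_tau : has_order tau T).
Local Notation C := R[i].
Local Notation ldif := (@latdif R _).
Variables (M2 M3 : weak_twisted_module tau T).
Implicit Types (phi : C -> M2 -> M3) (u v : V) (w : M2) (beta : C) (s : int).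

Definition prod_left s u phi beta w (a c : int) : M3 :=
  wtm_Y u (s + T%:Z *~ a) (phi (beta + 1 *~ c) w).

Definition prod_right s u phi beta w (a c : int) : M3 :=
  phi (beta + 1 *~ c) (wtm_Y u (s + T%:Z *~ a) w).

Section OneIntertwiner.
Variables (phi : C -> M2 -> M3) (phiP : is_intertwiner phi).

Lemma intw_lin alpha : linear (phi alpha).
Proof. exact: intw_linear phiP alpha. Qed.

Lemma prod_left_trr s u beta w : trr (prod_left s u phi beta w).
Proof.
have [N h] := intw_G1 phiP beta w; exists N => a c hc.
by rewrite /prod_left h// (lin_0 (wtm_linr _ _)).
Qed.

Lemma prod_right_trl s u beta w : trl (prod_right s u phi beta w).
Proof.
have [N h] := wtm_trunc_lattice aut_tau ord_tau u w s; exists N => a c ha.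
by rewrite /prod_right h// (lin_0 (intw_lin _)).
Qed.

Lemma intw_local v : exists k : nat, forall K, (k <= K)%N -> forall s beta w,
  iter K ldif (prod_left s v phi beta w) = iter K ldif (prod_right s v phi beta w).
Proof.
have [k h] := intw_G3 phiP v; exists k => K kK s beta w.
rewrite -(subnK kK) !iterD; congr (iter _ _ _).
apply/funext => a; apply/funext => c.
have := h (s + T%:Z *~ a) (beta + 1 *~ c) w.
rewrite !mul_x1Bx2E mulz_nat; last exact: prod_left_trr.
by rewrite mulz_mulz'// mulz'_nat//; exact: prod_right_trl.
Qed.

Lemma bt_local k s u beta w :
  iter k ldif (prod_left s u phi beta w) = iter k ldif (prod_right s u phi beta w) ->
  bt (iter k ldif (prod_left s u phi beta w)).
Proof.
move=> e; apply: bt_trlr; first by rewrite e; apply/trl_iter/prod_right_trl.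
exact/trr_iter/prod_left_trr.
Qed.

(** The offset beta + r/T on the left compensates for the factor x^{-r/T} of the definition. The
    exponent k is chosen before beta and w, which (G3) for u_n^H phi depends on. *)
Lemma intw_mode_diag_lt (r : nat) u : (r < T)%N -> eigsp tau T r u ->
  exists k : nat, forall K, (k <= K)%N -> forall beta w,
  iter K ldif (prod_left r%:Z u phi beta w) = iter K ldif (prod_right r%:Z u phi beta w) /\
  forall n c, intw_mode u n phi (beta + r%:R / T%:R + 1 *~ c) w
    = diag (r%:R / T%:R) (K%:Z - n - 1) (iter K ldif (prod_left r%:Z u phi beta w)) c.
Proof.
move=> rT ur; have [k h] := intw_local u; exists k => K kK beta w.
have e := h K kK r%:Z beta w; split=> // n c.
rewrite -(residue_diag (r%:R / T%:R) n c (prod_left_trr _ _ _ _) (prod_right_trl _ _ _ _) e).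
rewrite (intw_mode_eigsp aut_tau ord_tau n rT intw_lin ur) /intw_mode_homog.
rewrite zsum_nat; last by move=> j; rewrite binomz_neg ?scale0r.
apply: eq_fsbigr => j _; congr (_ *: _).
have -> : beta + r%:R / T%:R + 1 *~ c - r%:R / T%:R - j%:R = beta + 1 *~ (c - j%:Z).
  by rewrite rmorphB /=; ring.
have r0 : r%:Z = r%:Z + T%:Z *~ 0 by rewrite mulr0z addr0.
rewrite [X in mul_x1Bx2 _ _ _ _ X _]r0 [X in mul_Nx2Dx1 _ _ _ _ X _]r0.
by rewrite mul_x1Bx2E mul_Nx2Dx1E.
Qed.

Lemma intw_mode_diag (r : nat) u : eigsp tau T r u ->
  exists k : nat, forall K, (k <= K)%N -> forall beta w,
  iter K ldif (prod_left r%:Z u phi beta w) = iter K ldif (prod_right r%:Z u phi beta w) /\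
  forall n c, intw_mode u n phi (beta + r%:R / T%:R + 1 *~ c) w
    = diag (r%:R / T%:R) (K%:Z - n - 1) (iter K ldif (prod_left r%:Z u phi beta w)) c.
Proof.
move=> ur; have T0 := aut_order_gt0 ord_tau.
have r0T : (r %% T < T)%N by rewrite ltn_pmod.
have [k h] := intw_mode_diag_lt r0T (eigsp_mod ord_tau ur).
have [k' h'] := intw_local u.
exists (maxn k k') => K kK beta w; split.
  by apply: h'; apply: leq_trans kK; rewrite leq_maxr.
move=> n c; have [_ {}h] := h K (leq_trans (leq_maxl _ _) kK) beta w.
pose q : int := (r %/ T)%N%:Z.
have -> : beta + r%:R / T%:R + 1 *~ c = beta + (r %% T)%:R / T%:R + 1 *~ (c + q).
  by rewrite (nat_divE_ratio ord_tau) rmorphD /= -/q; ring.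
rewrite h -(diag_offset _ q) -(nat_divE_ratio ord_tau).
congr (diag _ _ _ _); apply/funext => a; apply/funext => b.
have sh i : forall a b, iter i ldif (prod_left (r %% T)%N u phi beta w) (a + q) b
   = iter i ldif (prod_left r%:Z u phi beta w) a b.
  elim: i => [|i IH] a' b'.
    rewrite /= /prod_left [in RHS](nat_divE T r) -/q; congr (wtm_Y _ _ _).
    by rewrite !mulrzz; ring.
  by rewrite !iterS /latdif -addrA [q + 1]addrC addrA !IH.
by rewrite sh.
Qed.

End OneIntertwiner.

(** * Closure of the space of intertwining operators under the modes *)

Lemma offset_split (alpha rho : C) : alpha = (alpha - rho) + rho + 1 *~ 0.
Proof. by rewrite subrK mulr0z addr0. Qed.

Lemma prod_left_linear k s u phi (philin : forall alpha, linear (phi alpha)) beta (d : C) w1 w2 :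
  iter k ldif (prod_left s u phi beta (d *: w1 + w2))
  = fun a c => d *: iter k ldif (prod_left s u phi beta w1) a c
               + iter k ldif (prod_left s u phi beta w2) a c.
Proof.
have -> : prod_left s u phi beta (d *: w1 + w2) =
    fun a c => d *: prod_left s u phi beta w1 a c + prod_left s u phi beta w2 a c.
  apply/funext => a; apply/funext => c; rewrite /prod_left philin.
  exact: wtm_linr.
have linS : linear (fun x : M3 => d *: x).
  by move=> e x y; rewrite scalerDr !scalerA mulrC.
apply/funext => a; apply/funext => c.
by rewrite iter_ldifD (iter_ldif_lin linS).
Qed.

Lemma diagDZ rho i (d : C) (f g : int -> int -> M3) c : bt f -> bt g ->
  diag rho i (fun a c => d *: f a c + g a c) c = d *: diag rho i f c + diag rho i g c.
Proof.
move=> bf bg; have linS : linear (fun x : M3 => d *: x).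
  by move=> e x y; rewrite scalerDr !scalerA mulrC.
by rewrite diagD ?(diag_lin linS)//; exact: (bt_lin linS).
Qed.

Definition lattice_deriv (rho beta : C) (f : int -> int -> M3) a c : M3 :=
  - (a%:~R + rho) *: f (a - 1) c - (c%:~R + beta) *: f a (c - 1).

(** The sum of the two partial derivatives kills x1 - x, hence commutes with multiplication by
    it. *)
Lemma lattice_deriv_ldif rho beta k f :
  lattice_deriv rho beta (iter k ldif f) = iter k ldif (lattice_deriv rho beta f).
Proof.
elim: k => [//|k IH]; rewrite [in RHS]iterS -IH iterS.
set g := iter k ldif f; apply/funext => a; apply/funext => c.
rewrite /lattice_deriv /latdif ?addrK ?subrK !rmorphD /=.
set x := a%:~R + rho; set y := c%:~R + beta.
have -> : a%:~R + 1%:~R + rho = x + 1 by rewrite /x; ring.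
have -> : c%:~R + 1%:~R + beta = y + 1 by rewrite /y; ring.
clearbody x y; rewrite !scaleNr !scalerDl !scale1r !scalerBr !opprD !opprK.
by rewrite [RHS](AC (3*(1*2)) ((1*4)*(3*5)*(2*6))) /= addNr addr0.
Qed.

Lemma intw_mode_hom_intertwiner (r : nat) u n phi : eigsp tau T r u ->
  is_intertwiner phi -> is_intertwiner (intw_mode u n phi).
Proof.
move=> ur phiP; have [k hk] := intw_mode_diag phiP ur.
have {}hk beta w := hk k (leqnn k) beta w.
pose rho : C := r%:R / T%:R; pose i := k%:Z - n - 1.
pose f beta w := iter k ldif (prod_left r%:Z u phi beta w).
have psiE beta w c : intw_mode u n phi (beta + rho + 1 *~ c) w = diag rho i (f beta w) c.
  by have [_ ->] := hk beta w.
have bf beta w : bt (f beta w) by apply: bt_local => //; case: (hk beta w).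
have psi0 alpha w : intw_mode u n phi alpha w = diag rho i (f (alpha - rho) w) 0.
  by rewrite {1}(offset_split alpha rho) psiE.
have psilin alpha : linear (intw_mode u n phi alpha).
  move=> d x y; rewrite !psi0 /f prod_left_linear; last exact: intw_lin.
  by rewrite diagDZ//; exact: bf.
have psiG1 alpha w : exists N : int, forall m : int, N <= m ->
    intw_mode u n phi (alpha + m%:~R) w = 0.
  have [N hN] := bf (alpha - rho) w; exists (N + N + 1 + i) => m hm.
  rewrite -[alpha](subrK rho) psiE; exact: (diag_trunc _ hN hm).
split => //.
- move=> alpha w; rewrite !psi0.
  rewrite -(diag_lin (wtm_linr (voa_omega V) 0))// -diagB//; last first.
    exact: (bt_lin (wtm_linr _ _)).
  rewrite /formal_deriv.
  have -> : alpha - 1 = (alpha - rho) + rho + 1 *~ (-1) by rewrite subrK mulrN1z.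
  rewrite psiE; set beta := alpha - rho.
  rewrite (_ : - alpha = - ((0 : int)%:~R + (rho + beta))); last first.
    by rewrite /beta mulr0z; ring.
  rewrite -[-1](add0r (-1)) -diag_deriv//.
  congr (diag _ _ _ _); rewrite -/(lattice_deriv rho beta (f beta w)).
  rewrite /f lattice_deriv_ldif; apply/funext => a; apply/funext => c.
  have -> := esym (congr1 (fun F => F a c)
    (iter_ldif_lin (wtm_linr (voa_omega V) 0) k (prod_left r%:Z u phi beta w))).
  rewrite -iter_ldifB.
  congr (iter _ _ _ _ _); apply/funext => a'; apply/funext => c'.
  rewrite /prod_left /lattice_deriv.
  have := wtm_translation aut_tau ord_tau a' (phi (beta + 1 *~ c') w) ur.
  (* This is (G2) for phi, solved for phi(x) L(-1) w. With [wtm_translation] for u it shows that the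
     commutator of L(-1) with Y(u,x1) phi(x) is the sum of its two partial derivatives. *)
  have t2 : phi (beta + 1 *~ c') (wtm_Y (voa_omega V) 0 w)
      = wtm_Y (voa_omega V) 0 (phi (beta + 1 *~ c') w)
        + (beta + 1 *~ c') *: phi (beta + 1 *~ (c' - 1)) w.
    have -> : beta + 1 *~ (c' - 1) = beta + 1 *~ c' - 1 by rewrite rmorphB /= addrA.
    have /eqP := intw_G2 phiP (beta + 1 *~ c') w.
    by rewrite /formal_deriv scaleNr subr_eq [X in _ == X]addrC eq_sym subr_eq => /eqP.
  rewrite t2 (lin_D (wtm_linr _ _)) (lin_Z (wtm_linr _ _)) [c'%:~R + _]addrC => <-.
  by rewrite opprD [LHS]addrA.
- move=> v.
  have [m [_ hope]] := wtm_ope aut_tau ord_tau M3 v ur.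
  have [l hl] := intw_local phiP v.
  (* [diag13_local] asks for j above the extracted order i. Of the other exponents, m comes from
     locality of u and v on M3, and l from that of v and phi. *)
  pose j := (absz i).+1.
  exists (m + j + l)%N => a0 beta0 w.
  pose beta := beta0 - rho.
  have E (F : int -> C -> M3) K : mul_x1Bx2 T%:Z 1 K F a0 beta0
      = mulz K (fun i j => F (a0 + T%:Z *~ i) (beta + rho + 1 *~ j)) 0 0.
    by rewrite -mul_x1Bx2E -offset_split mulr0z addr0.
  rewrite !E mulz_nat; last first.
    have [N hN] := psiG1 (beta + rho) w; exists N => a c hc.
    by rewrite hN// (lin_0 (wtm_linr _ _)).
  rewrite mulz_mulz'// mulz'_nat; last first.
    have [N hN] := wtm_trunc_lattice aut_tau ord_tau v w a0; exists N => a c ha.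
    by rewrite hN// (lin_0 (psilin _)).
  (* In [X] the operators stand in the order v, u, phi, in [Z] in the order u, phi, v. The order u,
     v, phi of [U] links them: (x1 - x2)^m exchanges u and v, and (x2 - x)^l exchanges v and phi. *)
  pose X a b c : M3 := wtm_Y v (a0 + T%:Z *~ b) (prod_left r%:Z u phi beta w a c).
  pose Z a b c : M3 := prod_left r%:Z u phi beta (wtm_Y v (a0 + T%:Z *~ b) w) a c.
  pose U a b c : M3 := wtm_Y u (r%:Z + T%:Z *~ a) (prod_left a0 v phi beta w b c).
  have X1E : iter k (@d13 _ _) X = fun a b c => wtm_Y v (a0 + T%:Z *~ b) (f beta w a c).
    apply/funext => a; apply/funext => b; apply/funext => c.
    by rewrite iter_d13E /X (iter_ldif_lin (wtm_linr _ _)).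
  have Z1E : iter k (@d13 _ _) Z = fun a b c => f beta (wtm_Y v (a0 + T%:Z *~ b) w) a c.
    by apply/funext => a; apply/funext => b; apply/funext => c; rewrite iter_d13E.
  have bX b : bt (fun a c => iter k (@d13 _ _) X a b c).
    by rewrite X1E; exact: (bt_lin (wtm_linr _ _)).
  have bZ b : bt (fun a c => iter k (@d13 _ _) Z a b c) by rewrite Z1E.
  have bl (Y : int -> int -> int -> M3) t : (forall b, bt (fun a c => Y a b c)) ->
      forall b, bt (fun a c => iter t (@d23 _ _) Y a b c).
    by move=> bY; elim: t => //= t IH; exact: bt13_d23.
  have dl (Y : int -> int -> int -> M3) t : (forall b, bt (fun a c => Y a b c)) ->
      diag13 rho i (iter t (@d23 _ _) Y) = iter t ldif (diag13 rho i Y).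
    by move=> bY; elim: t => //= t <-; rewrite diag13_d23//; exact: bl.
  rewrite (_ : (fun a c => wtm_Y v _ _) = diag13 rho i (iter k (@d13 _ _) X)); last first.
    apply/funext => b; apply/funext => c.
    by rewrite psiE X1E /diag13 (diag_lin (wtm_linr _ _)).
  rewrite (_ : (fun a c => intw_mode u n phi _ _) = diag13 rho i (iter k (@d13 _ _) Z)); last first.
    by apply/funext => b; apply/funext => c; rewrite psiE Z1E.
  rewrite !(iterD (m + j) l) -(dl _ l bX) -(dl _ l bZ).
  rewrite (@diag13_local _ _ rho m j i _ (iter l (@d23 _ _) (iter k (@d13 _ _) Z)))//.
  + by rewrite /j; lia.
  + exact: bl.
  + exact: bl.
  have c12_13 (Y : int -> int -> int -> M3) p q :
      iter p (@d12 _ _) (iter q (@d13 _ _) Y) = iter q (@d13 _ _) (iter p (@d12 _ _) Y).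
    by apply: iterC; exact: d12_d13C.
  have c12_23 (Y : int -> int -> int -> M3) p q :
      iter p (@d12 _ _) (iter q (@d23 _ _) Y) = iter q (@d23 _ _) (iter p (@d12 _ _) Y).
    by apply: iterC; exact: d12_d23C.
  have c13_23 (Y : int -> int -> int -> M3) p q :
      iter p (@d13 _ _) (iter q (@d23 _ _) Y) = iter q (@d23 _ _) (iter p (@d13 _ _) Y).
    by apply: iterC; exact: d13_d23C.
  rewrite c12_23 c12_13 (_ : iter m _ X = iter m (@d12 _ _) U); last first.
    apply/funext => a; apply/funext => b; apply/funext => c.
    by rewrite !iter_d12E; have [-> _] := hope a0 (phi (beta + 1 *~ c) w).
  rewrite -c12_13 -c12_23 -!c13_23 (_ : iter l _ U = iter l (@d23 _ _) Z)//.
  apply/funext => a; apply/funext => b; apply/funext => c.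
  rewrite !iter_d23E /U (iter_ldif_lin (wtm_linr _ _)) hl//.
  exact: (esym (congr1 (fun F => F b c) (iter_ldif_lin
    (wtm_linr u (r%:Z + T%:Z *~ a)) l (prod_right a0 v phi beta w)))).
Qed.

(** * Linearity, truncation and vacuum property of the modes *)

Lemma intw_mode_sum u n phi : is_intertwiner phi ->
  intw_mode u n phi = \sum_(r < T) intw_mode (eigproj tau T r u) n phi.
Proof.
move=> phiP; rewrite {1}/intw_mode; apply: eq_bigr => r _.
by rewrite (intw_mode_eigsp aut_tau ord_tau n (ltn_ord r) (intw_linear phiP)
  (eigproj_in aut_tau ord_tau r u)).
Qed.

Lemma sum_eval (I : Type) (l : seq I) (F : I -> C -> M2 -> M3) alpha w :
  (\sum_(j <- l) F j) alpha w = \sum_(j <- l) F j alpha w.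
Proof. exact: (big_morph (fun phi : C -> M2 -> M3 => phi alpha w)). Qed.

Lemma intw_mode_in u n phi : is_intertwiner phi -> intw_mode u n phi \in @intw_pred _ _ _ _ M2 M3.
Proof.
move=> phiP; rewrite intw_mode_sum//; apply: rpred_sum => r _; apply/asboolP.
by apply: intw_mode_hom_intertwiner phiP; exact: (eigproj_in aut_tau ord_tau r u).
Qed.

Lemma eigsp_linear (r : nat) (d : C) u v : eigsp tau T r u -> eigsp tau T r v ->
  eigsp tau T r (d *: u + v).
Proof.
have [linT _ _ _ _] := aut_tau.
by rewrite /eigsp /= linT => -> ->; rewrite scalerDr !scalerA [d * _]mulrC.
Qed.

Lemma eigproj_linear r : linear (eigproj tau T r : V -> V).
Proof.
have [linT _ _ _ _] := aut_tau.
have itl (s : nat) : linear (iter s tau).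
  by elim: s => [|s IH] d x y //=; rewrite IH linT.
move=> d x y; rewrite /eigproj scalerA mulrC -scalerA -scalerDr; congr (_ *: _).
rewrite scaler_sumr -big_split /=; apply: eq_bigr => s _.
by rewrite itl scalerDr !scalerA [d * _]mulrC.
Qed.

Lemma intw_mode_linl n phi alpha w : is_intertwiner phi ->
  linear (fun u => intw_mode u n phi alpha w).
Proof.
move=> phiP d u v.
suff hom (r : nat) u' v' : eigsp tau T r u' -> eigsp tau T r v' ->
    intw_mode (d *: u' + v') n phi alpha w = d *: intw_mode u' n phi alpha w + intw_mode v' n phi alpha w.
  rewrite !(intw_mode_sum _ _ phiP) !sum_eval scaler_sumr -big_split /=.
  apply: eq_bigr => r _; rewrite eigproj_linear.
  by apply: (hom r); exact: (eigproj_in aut_tau ord_tau r).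
move=> {u v} ur vr; have uvr := eigsp_linear d ur vr.
have [k1 h1] := intw_mode_diag phiP ur; have [k2 h2] := intw_mode_diag phiP vr.
have [k3 h3] := intw_mode_diag phiP uvr.
pose K := maxn k1 (maxn k2 k3); pose beta := alpha - r%:R / T%:R.
have {}h1 := h1 K (leq_maxl _ _) beta w.
have {}h2 : _ := h2 K (leq_trans (leq_maxl _ _) (leq_maxr _ _)) beta w.
have {}h3 : _ := h3 K (leq_trans (leq_maxr _ _) (leq_maxr _ _)) beta w.
rewrite (offset_split alpha (r%:R / T%:R)) -/beta h1.2 h2.2 h3.2.
rewrite -diagDZ; [|exact: bt_local h1.1|exact: bt_local h2.1].
congr (diag _ _ _ _).
have linS : linear (fun x : M3 => d *: x).
  by move=> e x y; rewrite scalerDr !scalerA mulrC.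
apply/funext => a; apply/funext => c.
have Ed (g : int -> int -> M3) : d *: iter K ldif g a c = iter K ldif (fun a c => d *: g a c) a c.
  exact: (esym (congr1 (fun F => F a c) (iter_ldif_lin linS K g))).
rewrite Ed -iter_ldifD.
congr (iter _ _ _ _ _); apply/funext => a'; apply/funext => c'.
exact: wtm_linl.
Qed.

Lemma intw_mode_linr u n (d : C) phi psi alpha w : is_intertwiner phi -> is_intertwiner psi ->
  intw_mode u n (d *: phi + psi) alpha w
  = d *: intw_mode u n phi alpha w + intw_mode u n psi alpha w.
Proof.
move=> phiP psiP.
have sumP : is_intertwiner (d *: phi + psi).
  apply/asboolP; apply: (intw_pred_submod M2 M3).2; exact/asboolP.
suff hom (r : nat) u' : eigsp tau T r u' ->
    intw_mode u' n (d *: phi + psi) alpha w = d *: intw_mode u' n phi alpha w + intw_mode u' n psi alpha w.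
  rewrite !intw_mode_sum// !sum_eval scaler_sumr -big_split /=.
  by apply: eq_bigr => r _; apply: (hom r); exact: (eigproj_in aut_tau ord_tau r).
move=> {u} ur.
have [k1 h1] := intw_mode_diag phiP ur; have [k2 h2] := intw_mode_diag psiP ur.
have [k3 h3] := intw_mode_diag sumP ur.
pose K := maxn k1 (maxn k2 k3); pose beta := alpha - r%:R / T%:R.
have {}h1 := h1 K (leq_maxl _ _) beta w.
have {}h2 : _ := h2 K (leq_trans (leq_maxl _ _) (leq_maxr _ _)) beta w.
have {}h3 : _ := h3 K (leq_trans (leq_maxr _ _) (leq_maxr _ _)) beta w.
rewrite (offset_split alpha (r%:R / T%:R)) -/beta h1.2 h2.2 h3.2.
rewrite -diagDZ; [|exact: bt_local h1.1|exact: bt_local h2.1].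
congr (diag _ _ _ _).
have linS : linear (fun x : M3 => d *: x).
  by move=> e x y; rewrite scalerDr !scalerA mulrC.
apply/funext => a; apply/funext => c.
have Ed (g : int -> int -> M3) : d *: iter K ldif g a c = iter K ldif (fun a c => d *: g a c) a c.
  exact: (esym (congr1 (fun F => F a c) (iter_ldif_lin linS K g))).
rewrite Ed -iter_ldifD.
congr (iter _ _ _ _ _); apply/funext => a'; apply/funext => c'.
exact: wtm_linr.
Qed.

(** The bound N is uniform in alpha and w, so u_n^H phi = 0 as an operator for large n and the sums
    in the Jacobi identity are finite in the space itself. *)
Lemma intw_mode_trunc u phi : is_intertwiner phi ->
  exists N : int, forall n, N <= n -> forall alpha w, intw_mode u n phi alpha w = 0.
Proof.
move=> phiP; elim/(eig_ind aut_tau ord_tau): u => [|u v [N uN] [K vK]|r u rT ur].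
- by exists 0 => n _ alpha w; rewrite (lin_0 (intw_mode_linl n alpha w phiP)).
- exists (Num.max N K) => n h alpha w.
  by rewrite (lin_D (intw_mode_linl n alpha w phiP)) uN ?vK ?addr0//; lia.
have [k h] := intw_mode_diag phiP ur; exists k%:Z => n kn alpha w.
have [_ {}h] := h k (leqnn k) (alpha - r%:R / T%:R) w.
by rewrite (offset_split alpha (r%:R / T%:R)) h diag_neg//; lia.
Qed.

Lemma intw_mode_vac n phi alpha w : is_intertwiner phi ->
  intw_mode (voa_vac V) n phi alpha w = if n == -1 then phi alpha w else 0.
Proof.
move=> phiP; have vacP := vac_eigsp T aut_tau.
have [k h] := intw_mode_diag phiP vacP.
have [_ {}h] := h k (leqnn k) (alpha - 0%:R / T%:R) w.
rewrite {1}(offset_split alpha (0%:R / T%:R)) h.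
set g := prod_left _ _ _ _ _.
have T0 := aut_order_gt0 ord_tau.
have gE a c : g a c = if a == -1 then phi (alpha + 1 *~ c) w else 0.
  rewrite /g /prod_left mul0r subr0 (wtm_vacuum (wtm_axioms M3)) mulrzz.
  by congr (if _ then _ else _); apply/eqP/eqP; nia.
have bg : bt g.
  have [N hN] := intw_G1 phiP alpha w; exists (Num.max 0 N) => a c hac; rewrite gE.
  case: eqP => // a1; apply: hN; lia.
rewrite diag_iter// /diag (@zsum1 _ _ (-1)); last by move=> a /negbTE a1; rewrite gE a1 scaler0.
rewrite gE eqxx.
(* Y(1,x1) contributes only x1^0, and (x + z)^0 contains no positive power of z, so only n = -1
   survives. *)
have -> : - (-1)%:~R - 1 - 0%:R / T%:R = 0 :> C by rewrite mul0r; ring.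
case: eqP => [->|n1].
  rewrite (_ : k%:Z - -1 - 1 - k%:Z = 0); last by lia.
  by rewrite binomz0 scale1r (_ : 0 - 1 - 0 - -1 = 0 :> int) ?mulr0z ?addr0//; lia.
by rewrite binomz_zero ?scale0r//; lia.
Qed.

End Intertwiners.

(** * Compatibility of the two expansions with linear maps and sums *)

Section LatticeAdditivity.
Variables (R : realType) (W W' : lmodType R[i]).
Local Notation ldif := (@latdif R _).

Lemma mul_x1Bx2_int n (F : int -> int -> W) a b : mul_x1Bx2 1%:Z 1%:Z n F a b = mulz n F a b.
Proof.
rewrite /mulz /zconv zsum_nat => [|j]; last by rewrite /mulz_l binomz_neg ?mulr0 ?scale0r.
by apply: eq_fsbigr => j _; rewrite /mulz_l !mulrzz !mul1r addrA.
Qed.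

Lemma mul_Nx2Dx1_int n (F : int -> int -> W) a b : mul_Nx2Dx1 1%:Z 1%:Z n F a b = mulz' n F a b.
Proof.
rewrite /mulz' /zconv -(zsum_refl n) zsum_nat => [|j]; last first.
  by rewrite /mulz_r subKr binomz_neg ?mulr0 ?scale0r.
apply: eq_fsbigr => j _; rewrite /mulz_r subKr !mulrzz !mul1r.
by rewrite (_ : a + n - (n - j%:Z) = a + j%:Z)//; lia.
Qed.

Lemma mulz_lin (L : W -> W') n (F : int -> int -> W) a b : linear L -> trr F ->
  L (mulz n F a b) = mulz n (fun a b => L (F a b)) a b.
Proof.
move=> linL tF; rewrite /mulz /zconv (zsum_lin linL); last exact: mulz_l_fin.
by apply: eq_zsum => j /=; rewrite (lin_Z linL).
Qed.

Lemma mulz'_lin (L : W -> W') n (F : int -> int -> W) a b : linear L -> trl F ->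
  L (mulz' n F a b) = mulz' n (fun a b => L (F a b)) a b.
Proof.
move=> linL tF; rewrite /mulz' /zconv (zsum_lin linL); last exact: mulz_r_fin.
by apply: eq_zsum => j /=; rewrite (lin_Z linL).
Qed.

Lemma mulzD n (F G : int -> int -> W) a b : trr F -> trr G ->
  mulz n (fun a b => F a b + G a b) a b = mulz n F a b + mulz n G a b.
Proof.
move=> tF tG; rewrite /mulz /zconv -zsumD; try exact: mulz_l_fin.
by apply: eq_zsum => j; rewrite scalerDr.
Qed.

Lemma mulz'D n (F G : int -> int -> W) a b : trl F -> trl G ->
  mulz' n (fun a b => F a b + G a b) a b = mulz' n F a b + mulz' n G a b.
Proof.
move=> tF tG; rewrite /mulz' /zconv -zsumD; try exact: mulz_r_fin.
by apply: eq_zsum => j; rewrite scalerDr.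
Qed.

Lemma iter_d13_swap l (e : R[i]) (Z : int -> int -> int -> W) :
  iter l (@d13 R W) (fun b a c => e *: Z a b c)
  = fun b a c => e *: iter l (@d23 R W) Z a b c.
Proof.
elim: l => [//|l IH]; apply/funext => b; apply/funext => a; apply/funext => c.
by rewrite !iterS IH /d13 /d23 scalerBr.
Qed.

End LatticeAdditivity.

(** * The Borcherds identity for the action *)

Section Action.
Variables (R : realType) (V : voa R) (tau : V -> V) (T : nat).
Hypotheses (aut_tau : voa_automorphism tau) (ord_tau : has_order tau T).
Local Notation C := R[i].
Local Notation ldif := (@latdif R _).
Variables (M2 M3 : weak_twisted_module tau T).
Implicit Types (u v : V) (w : M2).

Lemma intertwiner0 : is_intertwiner (0 : C -> M2 -> M3).
Proof. by apply/asboolP; apply: (intw_pred_submod M2 M3).1. Qed.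

Lemma intw_mode_0r u n alpha w : intw_mode u n (0 : C -> M2 -> M3) alpha w = 0.
Proof.
have := intw_mode_linr aut_tau ord_tau u n (-1) alpha w intertwiner0 intertwiner0.
by rewrite scaler0 addr0 scaleN1r addNr.
Qed.

Section OneIntertwiner.
Variables (phi : C -> M2 -> M3) (phiP : is_intertwiner phi).

Lemma intw_modeP u n : is_intertwiner (intw_mode u n phi).
Proof. exact/asboolP/(intw_mode_in aut_tau ord_tau). Qed.

Lemma intw_mode_diag_zero (r : nat) v (l : nat) q :
  (forall beta w,
    iter l ldif (prod_left r%:Z v phi beta w) = iter l ldif (prod_right r%:Z v phi beta w) /\
    forall n c, intw_mode v n phi (beta + r%:R / T%:R + 1 *~ c) w
      = diag (r%:R / T%:R) (l%:Z - n - 1) (iter l ldif (prod_left r%:Z v phi beta w)) c) ->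
  l%:Z <= q -> intw_mode v q phi = 0.
Proof.
move=> h lq; apply/funext => alpha; apply/funext => w.
have [_ {}h] := h (alpha - r%:R / T%:R) w.
by rewrite (offset_split alpha (r%:R / T%:R)) h diag_neg//; lia.
Qed.

Lemma intw_borcherds_hom (r s : nat) u v n p q alpha w :
  eigsp tau T r u -> eigsp tau T s v ->
  mulz n (fun p q => intw_mode u p (intw_mode v q phi) alpha w) p q
  - mulz' n (fun p q => intw_mode v q (intw_mode u p phi) alpha w) p q
  = zsum (fun j => binomz p%:~R j *: intw_mode (voa_Y u (n + j) v) (p + q - j) phi alpha w).
Proof.
move=> ur vs.
have [m [uv0 hope]] := wtm_ope aut_tau ord_tau M3 v ur.
have [k hk0] := intw_mode_diag aut_tau ord_tau phiP ur.
have [l hl0] := intw_mode_diag aut_tau ord_tau phiP vs.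
have {hk0}hk beta w' := hk0 k (leqnn k) beta w'.
have {hl0}hl beta w' := hl0 l (leqnn l) beta w'.
pose rho : C := r%:R / T%:R; pose sigma : C := s%:R / T%:R.
(* Acting by u and v raises the offset by rho and sigma, so the coefficient at alpha becomes mode 0
   counted from beta + rho + sigma. *)
pose beta := alpha - rho - sigma.
(* Four orders of u, v and phi that agree after multiplication by suitable differences. The operator
   acting first on w gives the truncation: [F] in x, [F1] in x2 and [F2] in x1. Together they bound
   G in all three variables. *)
pose F a b c : M3 := wtm_Y u (r%:Z + T%:Z *~ a) (prod_left s%:Z v phi beta w b c).
pose F' a b c : M3 := wtm_Y v (s%:Z + T%:Z *~ b) (prod_left r%:Z u phi beta w a c).
pose F1 a b c : M3 := wtm_Y u (r%:Z + T%:Z *~ a) (prod_right s%:Z v phi beta w b c).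
pose F2 a b c : M3 := wtm_Y v (s%:Z + T%:Z *~ b) (prod_right r%:Z u phi beta w a c).
pose D12 := @d12 R M3; pose D13 := @d13 R M3; pose D23 := @d23 R M3.
have c12_13 Y i j : iter i D12 (iter j D13 Y) = iter j D13 (iter i D12 Y).
  by apply: iterC; exact: d12_d13C.
have c12_23 Y i j : iter i D12 (iter j D23 Y) = iter j D23 (iter i D12 Y).
  by apply: iterC; exact: d12_d23C.
have c13_23 Y i j : iter i D13 (iter j D23 Y) = iter j D23 (iter i D13 Y).
  by apply: iterC; exact: d13_d23C.
have e12 : iter m D12 F = iter m D12 F'.
  apply/funext => a; apply/funext => b; apply/funext => c.
  by rewrite !iter_d12E; have [-> _] := hope s%:Z (phi (beta + 1 *~ c) w).
have F23 a b c : iter l D23 F a b c = wtm_Y u (r%:Z + T%:Z *~ a)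
    (iter l ldif (prod_left s%:Z v phi beta w) b c).
  by rewrite iter_d23E /F (iter_ldif_lin (wtm_linr _ _)).
have F13 a b c : iter k D13 F' a b c = wtm_Y v (s%:Z + T%:Z *~ b)
    (iter k ldif (prod_left r%:Z u phi beta w) a c).
  by rewrite iter_d13E /F' (iter_ldif_lin (wtm_linr _ _)).
have e23 : iter l D23 F = iter l D23 F1.
  apply/funext => a; apply/funext => b; apply/funext => c.
  by rewrite F23 iter_d23E /F1 (iter_ldif_lin (wtm_linr _ _)) (hl _ _).1.
have e13 : iter k D13 F' = iter k D13 F2.
  apply/funext => a; apply/funext => b; apply/funext => c.
  by rewrite F13 iter_d13E /F2 (iter_ldif_lin (wtm_linr _ _)) (hk _ _).1.
pose G := iter k D13 (iter l D23 (iter m D12 F)).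
have GE1 : G = iter k D13 (iter m D12 (iter l D23 F)) by rewrite /G c12_23.
have GE2 : G = iter l D23 (iter m D12 (iter k D13 F')) by rewrite /G e12 c13_23 c12_13.
have GE3 : G = iter l D23 (iter k D13 (iter m D12 F)) by rewrite /G c13_23.
have triG : tri G.
  have [N1 h1] := intw_G1 phiP beta w.
  have [N2 h2] := wtm_trunc_lattice aut_tau ord_tau v w s%:Z.
  have [N3 h3] := wtm_trunc_lattice aut_tau ord_tau u w r%:Z.
  have v1 : vanish (fun _ _ c => N1 <= c) G.
    rewrite /G; apply: vanish_d13; try by move=> *; lia.
    apply: vanish_d23; try by move=> *; lia.
    apply: vanish_d12; try by move=> *; lia.
    by move=> a b c hc; rewrite /F /prod_left h1// !(lin_0 (wtm_linr _ _)).
  have v2 : vanish (fun _ b _ => N2 <= b) G.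
    rewrite GE1 e23; apply: vanish_d13; try by move=> *; lia.
    apply: vanish_d12; try by move=> *; lia.
    apply: vanish_d23; try by move=> *; lia.
    move=> a b c hb; rewrite /F1 /prod_right h2// (lin_0 (intw_linear phiP _)).
    exact: (lin_0 (wtm_linr _ _)).
  have v3 : vanish (fun a _ _ => N3 <= a) G.
    rewrite GE2 e13; apply: vanish_d23; try by move=> *; lia.
    apply: vanish_d12; try by move=> *; lia.
    apply: vanish_d13; try by move=> *; lia.
    move=> a b c ha; rewrite /F2 /prod_right h3// (lin_0 (intw_linear phiP _)).
    exact: (lin_0 (wtm_linr _ _)).
  exists (Num.max N1 (Num.max N2 N3)) => a b c [h|h|h].
  - by apply: v3; lia.
  - by apply: v2; lia.
  - by apply: v1; lia.
pose h i j := diag rho i (diag23 sigma j G) 0.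
have btl : bt (iter l ldif (prod_left s%:Z v phi beta w)).
  by apply: (bt_local aut_tau ord_tau phiP); exact: (hl _ _).1.
have btk : bt (iter k ldif (prod_left r%:Z u phi beta w)).
  by apply: (bt_local aut_tau ord_tau phiP); exact: (hk _ _).1.
apply: (borcherds_of_modes (k := k) (l := l) (m := m) (h := h)
  (Q := fun n q => intw_mode (voa_Y u n v) q phi alpha w)).
- by move=> p' q' lq; rewrite (intw_mode_diag_zero hl lq) intw_mode_0r.
- by move=> p' q' kp; rewrite (intw_mode_diag_zero hk kp) intw_mode_0r.
- move=> p' q'.
  rewrite (left_modesE (rho := rho) (sigma := sigma) (l := l%:Z) (X := iter l D23 F) (k := k)).
  + by rewrite -GE1.
  + move=> a; have -> : iter l D23 F a = fun b c => wtm_Y u (r%:Z + T%:Z *~ a)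
        (iter l ldif (prod_left s%:Z v phi beta w) b c).
      by apply/funext => b; apply/funext => c; exact: F23.
    exact: (bt_lin (wtm_linr _ _) btl).
  + move=> p2 q2.
    have [K hK] := intw_mode_diag aut_tau ord_tau (intw_modeP v q2) ur.
    have {hK}[e1 e2] := hK K (leqnn K) (beta + sigma) w.
    have pE : prod_left r%:Z u (intw_mode v q2 phi) (beta + sigma) w
        = diag23 sigma (l%:Z - q2 - 1) (iter l D23 F).
      apply/funext => a; apply/funext => c; rewrite /prod_left (hl beta w).2.
      rewrite -(diag_lin (wtm_linr _ _) _ _ _ btl) /diag23; congr (diag _ _ _ _).
      by apply/funext => b; apply/funext => c'; rewrite F23.
    exists K; rewrite -pE; split; first exact: (bt_local aut_tau ord_tau (intw_modeP v q2)).
    by rewrite -e2 mulr0z addr0 /beta subrK subrK.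
  by rewrite -GE1.
- move=> p' q'.
  pose X b a c := iter k D13 F' a b c.
  (* For the second product [left_modesE] is applied with x1 and x2 exchanged. This turns (x1 -
     x2)^m into its multiple by (-1)^m, both on the series and on the modes, and the two signs
     cancel. *)
  pose sg : C := (-1) ^+ m.
  have GX : iter l D13 (iter m D12 X) = fun b a c => sg *: G a b c.
    by rewrite /X iter_d12_swap iter_d13_swap -GE2.
  have triX : tri (iter l D13 (iter m D12 X)).
    rewrite GX; have [N hN] := triG; exists N => b a c hbac.
    by rewrite hN ?scaler0//; case: hbac => ?; [constructor 2|constructor 1|constructor 3].
  have := left_modesE (rho := sigma) (sigma := rho) (l := k%:Z) (X := X)
    (P := fun q p => intw_mode v q (intw_mode u p phi) alpha w) _ _ triX q' p'.
  rewrite GX iter_ldif_swap => eX.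
  have linS : linear (fun x : M3 => sg *: x).
    by move=> e x y; rewrite scalerDr !scalerA mulrC.
  suff : sg *: iter m ldif (fun p q => intw_mode v q (intw_mode u p phi) alpha w) p' q'
      = sg *: h (k%:Z - p' - 1) (l%:Z - q' - 1).
    move/(congr1 (fun x => sg *: x)); rewrite !scalerA /sg -expr2 sqrr_sign !scale1r.
    by move=> ->.
  rewrite eX.
  + rewrite /h (diag13_diag23 rho sigma _ _ _ triG) -(diag_lin linS); last exact: bt_diag13.
    congr (diag _ _ _ _); apply/funext => b; apply/funext => c.
    by rewrite /diag23 /diag13 (diag_lin linS)//; exact: tri_bt13.
  + move=> b; have -> : X b = fun a c => wtm_Y v (s%:Z + T%:Z *~ b)
        (iter k ldif (prod_left r%:Z u phi beta w) a c).
      by apply/funext => a; apply/funext => c; exact: F13.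
    exact: (bt_lin (wtm_linr _ _) btk).
  + move=> q2 p2.
    have [K hK] := intw_mode_diag aut_tau ord_tau (intw_modeP u p2) vs.
    have {hK}[e1 e2] := hK K (leqnn K) (beta + rho) w.
    have pE : prod_left s%:Z v (intw_mode u p2 phi) (beta + rho) w
        = diag23 rho (k%:Z - p2 - 1) X.
      apply/funext => b; apply/funext => c; rewrite /prod_left (hk beta w).2.
      rewrite -(diag_lin (wtm_linr _ _) _ _ _ btk) /diag23; congr (diag _ _ _ _).
      by apply/funext => a; apply/funext => c'; rewrite /X F13.
    exists K; rewrite -pE; split; first exact: (bt_local aut_tau ord_tau (intw_modeP u p2)).
    rewrite -e2 mulr0z addr0 -/sigma (_ : beta + rho + sigma = alpha)//.
    by rewrite /beta; ring.
- by move=> n' q' mn; rewrite uv0// (lin_0 (intw_mode_linl aut_tau ord_tau _ _ _ phiP)).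
(* Weak associativity: by [wtm_ope] in M3 the series Y(u_n v, x2) phi(x) comes from (x1 - x2)^m
   Y(u,x1) Y(v,x2) phi(x) by the substitution x1 = x2 + z0. *)
- move=> n' q' nm.
  rewrite (iter_modesE (rho := rho) (sigma := sigma) (m := m%:Z) (X := iter m D12 F) (l := l)).
  + by rewrite -GE3 diag12_diag23//; lia.
  + move=> c; rewrite (_ : (fun a b => _) = iter m ldif (fun a b => F a b c)); last first.
      by apply/funext => a; apply/funext => b; rewrite iter_d12E.
    have [e _] := hope s%:Z (phi (beta + 1 *~ c) w).
    apply: bt_trlr; last exact/trr_iter/(wtm_trr aut_tau ord_tau).
    by rewrite /F e; apply/trl_iter/(wtm_trl aut_tau ord_tau).
  + move=> n2 q2.
    have [K hK] := intw_mode_diag aut_tau ord_tau phiP (eigsp_Y aut_tau n2 ur vs).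
    have {hK}[e1 e2] := hK K (leqnn K) beta w.
    have pE : prod_left (r + s)%N%:Z (voa_Y u n2 v) phi beta w
        = diag12 rho (m%:Z - n2 - 1) (iter m D12 F).
      apply/funext => b; apply/funext => c; rewrite /prod_left PoszD.
      have [_ ->] := hope s%:Z (phi (beta + 1 *~ c) w).
      rewrite /diag12; congr (diag _ _ _ _); apply/funext => a; apply/funext => b'.
      by rewrite iter_d12E.
    have rsE : (r + s)%:R / T%:R = rho + sigma by rewrite natrD mulrDl.
    rewrite rsE in e2.
    exists K; rewrite -pE; split; first exact: (bt_local aut_tau ord_tau phiP).
    rewrite -e2 mulr0z addr0 (_ : beta + (rho + sigma) = alpha)//.
    by rewrite /beta; ring.
  by rewrite -GE3.
- by move=> i j i0; rewrite /h diag_neg.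
Qed.

Lemma intw_comp_trr u v alpha w :
  trr (fun p q => intw_mode u p (intw_mode v q phi) alpha w).
Proof.
have [N hN] := intw_mode_trunc aut_tau ord_tau v phiP; exists N => p q hq.
rewrite (_ : intw_mode v q phi = 0) ?intw_mode_0r//.
by apply/funext => a; apply/funext => x; exact: hN.
Qed.

Lemma intw_comp_trl u v alpha w :
  trl (fun p q => intw_mode v q (intw_mode u p phi) alpha w).
Proof. by have [N hN] := intw_comp_trr v u alpha w; exists N => p q; exact: hN. Qed.

Lemma zfin_voa (u v : V) n p (F : V -> int -> M3) : (forall j, F 0 j = 0) ->
  zfin (fun j => binomz p%:~R j *: F (voa_Y u (n + j) v) j).
Proof.
move=> F0; apply: zfin_binom; have [N hN] := voa_trunc u v.
by exists (N - n) => j hj; rewrite hN ?F0//; lia.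
Qed.

Definition intw_borcherds_at alpha w u v := forall n p q,
  mulz n (fun p q => intw_mode u p (intw_mode v q phi) alpha w) p q
  - mulz' n (fun p q => intw_mode v q (intw_mode u p phi) alpha w) p q
  = zsum (fun j => binomz p%:~R j *: intw_mode (voa_Y u (n + j) v) (p + q - j) phi alpha w).

Section Bilinearity.
Variables (alpha : C) (w : M2).

Lemma intw_mode_Dl u v n psi : is_intertwiner psi ->
  intw_mode (u + v) n psi = intw_mode u n psi + intw_mode v n psi :> (C -> M2 -> M3).
Proof.
move=> psiP; apply/funext => a; apply/funext => x.
exact: (lin_D (intw_mode_linl aut_tau ord_tau n a x psiP)).
Qed.

Lemma intw_mode_Dr u n psi chi : is_intertwiner psi -> is_intertwiner chi ->
  intw_mode u n (psi + chi) alpha w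
  = intw_mode u n psi alpha w + intw_mode u n chi alpha w :> M3.
Proof.
move=> psiP chiP.
have := intw_mode_linr aut_tau ord_tau u n 1 alpha w psiP chiP.
by rewrite !scale1r.
Qed.

(** The vectors x and x' are kept abstract so that the same lemma gives additivity in u and in v. *)
Lemma intw_borcherdsD u u' v v' x x' :
  (forall n, voa_Y x n x' = voa_Y u n v + voa_Y u' n v') ->
  (forall p q, intw_mode x p (intw_mode x' q phi) alpha w
     = intw_mode u p (intw_mode v q phi) alpha w + intw_mode u' p (intw_mode v' q phi) alpha w) ->
  (forall p q, intw_mode x' q (intw_mode x p phi) alpha w
     = intw_mode v q (intw_mode u p phi) alpha w + intw_mode v' q (intw_mode u' p phi) alpha w) ->
  intw_borcherds_at alpha w u v -> intw_borcherds_at alpha w u' v' ->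
  intw_borcherds_at alpha w x x'.
Proof.
move=> xY xl xr B B' n p q.
have F0 j : intw_mode 0 (p + q - j) phi alpha w = 0
  := lin_0 (intw_mode_linl aut_tau ord_tau _ _ _ phiP).
have fin y z := @zfin_voa y z n p (fun x j => intw_mode x (p + q - j) phi alpha w) F0.
rewrite (_ : (fun p q => intw_mode x p _ _ _) = fun p q =>
    intw_mode u p (intw_mode v q phi) alpha w + intw_mode u' p (intw_mode v' q phi) alpha w); last first.
  by apply/funext => p'; apply/funext => q'; exact: xl.
rewrite (_ : (fun p q => intw_mode x' q _ _ _) = fun p q =>
    intw_mode v q (intw_mode u p phi) alpha w + intw_mode v' q (intw_mode u' p phi) alpha w); last first.
  by apply/funext => p'; apply/funext => q'; exact: xr.
rewrite mulzD; try exact: intw_comp_trr.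
rewrite mulz'D; try exact: intw_comp_trl.
rewrite opprD addrACA B B' -zsumD; try exact: fin.
apply: eq_zsum => j; rewrite -scalerDr; congr (_ *: _).
by rewrite -(lin_D (intw_mode_linl aut_tau ord_tau _ _ _ phiP)) xY.
Qed.

End Bilinearity.

Lemma intw_borcherds u v alpha w : intw_borcherds_at alpha w u v.
Proof.
have zero : eigsp tau T 0 (0 : V).
  have [linT _ _ _ _] := aut_tau.
  by rewrite /eigsp /= scaler0 (lin_0 linT).
have homl (r : nat) u' : eigsp tau T r u' -> intw_borcherds_at alpha w u' v.
  move=> ur; elim/(eig_ind aut_tau ord_tau): v => [|v v' IH IH'|s v sT vs].
  - by move=> n p q; exact: (intw_borcherds_hom n p q alpha w ur zero).
  - apply: (intw_borcherdsD _ _ _ IH IH').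
    + by move=> n; rewrite (lin_D (voa_Y_linearr _ _)).
    + by move=> p q; rewrite intw_mode_Dl// intw_mode_Dr//; exact: intw_modeP.
    + by move=> p q; rewrite intw_mode_Dl//; exact: intw_modeP.
  - by move=> n p q; exact: (intw_borcherds_hom n p q alpha w ur vs).
elim/(eig_ind aut_tau ord_tau): u => [|u u' IH IH'|r u rT ur].
- exact: homl zero.
- apply: (intw_borcherdsD _ _ _ IH IH').
  + by move=> n; rewrite (lin_D (voa_Y_linearl _ _)).
  + by move=> p q; rewrite intw_mode_Dl//; exact: intw_modeP.
  + by move=> p q; rewrite intw_mode_Dl// intw_mode_Dr//; exact: intw_modeP.
- exact: homl ur.
Qed.

End OneIntertwiner.

(** * The weak module structure on the space of intertwining operators *)

Definition intw_action u n (phi : intw_space M2 M3) : intw_space M2 M3 :=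
  IntwSpace (intw_mode_in aut_tau ord_tau u n (intw_valP phi)).

Lemma intw_spaceP (phi psi : intw_space M2 M3) :
  (forall alpha w, phi alpha w = psi alpha w) -> phi = psi.
Proof.
by move=> h; apply: val_inj; apply/funext => alpha; apply/funext => w; exact: h.
Qed.

Lemma intw_eval_linear alpha w : linear (fun phi : intw_space M2 M3 => phi alpha w).
Proof. by []. Qed.

Lemma intw_action_trr u v (phi : intw_space M2 M3) :
  trr (fun p q => intw_action u p (intw_action v q phi)).
Proof.
have [N hN] := intw_mode_trunc aut_tau ord_tau v (intw_valP phi); exists N => p q hq.
apply: intw_spaceP => alpha w /=.
rewrite (_ : intw_mode v q phi = 0) ?intw_mode_0r//.
by apply/funext => a; apply/funext => x; exact: hN.
Qed.

Lemma intw_action_trl u v (phi : intw_space M2 M3) :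
  trl (fun p q => intw_action v q (intw_action u p phi)).
Proof. by have [N hN] := intw_action_trr v u phi; exists N => p q; exact: hN. Qed.

Lemma intw_action_jacobi u v (phi : intw_space M2 M3) :
  jacobi (@voa_Y R V) 1 0 intw_action u v phi.
Proof.
move=> n a b.
have z1 (c : int) : c = 0 + 1%:Z *~ c by rewrite add0r mulrzz mul1r.
rewrite mul_x1Bx2_int mul_Nx2Dx1_int.
have aE : a = (0%:Z + 1%:Z * 0) + 1%:Z *~ a by rewrite mulr0 addr0 -z1.
rewrite [in RHS]aE [in RHS](z1 b).
rewrite (jacobi_rhsE _ _ _ _ _ (fun j l => intw_action (voa_Y u (n + j%:Z) v) l phi))//.
transitivity (zsum (fun j => binomz a%:~R j *: intw_action (voa_Y u (n + j) v) (a + b - j) phi)).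
  (* Evaluation at alpha and w is linear and passes through the sums, which are finite in the space
     of operators; this reduces the claim to [intw_borcherds]. *)
  apply: intw_spaceP => alpha w; have ev := intw_eval_linear alpha w.
  rewrite [LHS](lin_B ev).
  have -> := mulz_lin n a b ev (intw_action_trr u v phi).
  have -> := mulz'_lin n a b ev (intw_action_trl u v phi).
  rewrite (intw_borcherds (intw_valP phi) u v alpha w n a b).
  rewrite [RHS](zsum_lin ev) => [|]; last first.
    apply: zfin_binom; have [N hN] := voa_trunc u v; exists (N - n) => j hj.
    apply: intw_spaceP => al x; rewrite hN; last by lia.
    exact: (lin_0 (intw_mode_linl aut_tau ord_tau _ _ _ (intw_valP phi))).
  by [].
rewrite zsum_nat; last by move=> j; rewrite binomz_neg ?scale0r.
apply: eq_fsbigr => j _; rewrite mul0r add0r mulr0z addr0.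
by rewrite mulr0 !add0r mulrzz mul1r.
Qed.

Lemma intw_action_weak_module : is_weak_module intw_action.
Proof.
split.
- move=> n phi d u v; apply: intw_spaceP => alpha w.
  exact: (intw_mode_linl aut_tau ord_tau n alpha w (intw_valP phi)).
- move=> u n d phi psi; apply: intw_spaceP => alpha w.
  exact: (intw_mode_linr aut_tau ord_tau u n d alpha w (intw_valP phi) (intw_valP psi)).
- by move=> r u _ _ k; rewrite dvd1z.
- move=> r u phi _ _; have [N hN] := intw_mode_trunc aut_tau ord_tau u (intw_valP phi).
  by exists N => k Nk; apply: intw_spaceP => alpha w; exact: hN.
- move=> k phi; apply: intw_spaceP => alpha w.
  rewrite [LHS](intw_mode_vac aut_tau ord_tau k alpha w (intw_valP phi)).
  by case: ifP.
- by move=> [|//] u v phi _ _; exact: intw_action_jacobi.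
Qed.

End Action.

Theorem theorem4p6 (R : realType) (V : voa R) (tau : V -> V) (T : nat)
    (htau : voa_automorphism tau) (hT : has_order tau T)
    (M2 M3 : weak_twisted_module tau T) :
  exists YH : V -> int -> intw_space M2 M3 -> intw_space M2 M3,
    (forall u n phi, intw_val (YH u n phi) = intw_mode u n (intw_val phi)) /\
    is_weak_module YH.
Proof.
exists (intw_action htau hT (M2 := M2) (M3 := M3)); split=> //.
exact: intw_action_weak_module.
Qed.
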